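(* Let $\omega$ be a solution of the elliptic sinh-Gordon equation \[ \omega_{\zeta\bar\zeta}=-\frac{K_N}{2}\sinh 2\omega , \] where $K_N$ is a constant, and let $u$ be a solution of the Beltrami equation \[ \frac{u_{\bar\zeta}}{u_\zeta}=e^{-2\omega(\zeta,\bar\zeta)} .\qquad ( * ) \] Then a harmonic map $U=U(\zeta,\bar\zeta)$ to $N$ that satisfies $( * )$ (that is, $U_{\bar\zeta}/U_\zeta=e^{-2\omega}$) can be written as \[ U=f\bigl(u(\zeta,\bar\zeta)\bigr), \] where $f(z)$ is holomorphic and the metric on $N$ is of constant curvature $K_N$. Consequently, there is a classification of harmonic diffeomorphisms via the classification of the solutions of the sinh-Gordon equation.
   Context: The setting is that of harmonic diffeomorphisms $M\to N$ between Riemann surfaces with nonvanishing Hopf differential, written in isothermal coordinates as complex-valued functions. Here $\omega$ is real-valued, $\zeta=\xi+i\eta$, $\partial_\zeta=\frac12(\partial_\xi-i\partial_\eta)$ and $\partial_{\bar\zeta}=\frac12(\partial_\xi+i\partial_\eta)$. If the metric of $N$ is $e^{F(U,\bar U)}|dU|^2$ ($F$ real-valued), a map $U$ to $N$ is harmonic if $U_{\zeta\bar\zeta}+F_U(U,\bar U)\,U_\zeta U_{\bar\zeta}=0$, and the Gauss curvature of $N$ is $-2F_{U\bar U}e^{-F}$. The Hopf differential of a harmonic map, in an isothermal coordinate $z$ on $M$, is holomorphic and is written $e^{F}U_z\bar U_z\,dz^2=e^{-\lambda(z)}dz^2$ with $\lambda$ holomorphic, where $\bar U_z=\partial_z\bar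 U$. The letter $\zeta$ denotes the specific coordinate on $M$ given by the conformal change of variable $\zeta=\int e^{-\lambda(z)/2}\,dz$.
   Formalization: U = f(u) with one global holomorphic f is proved when u is injective, and locally around each point otherwise (it fails globally for u = exp(U)); U is assumed a local diffeomorphism onto N, as in the setting of harmonic diffeomorphisms (ω = 0 gives degenerate counterexamples). *)

(* Defs.v *)
From Stdlib Require Export Reals.
From Coquelicot Require Export Coquelicot.
Open Scope R_scope.

Definition d_xi (f : C -> C) (z : C) : C :=
  (Derive (fun t : R => Re (f (t, Im z))) (Re z),
   Derive (fun t : R => Im (f (t, Im z))) (Re z)).

Definition d_eta (f : C -> C) (z : C) : C :=
  (Derive (fun t : R => Re (f (Re z, t))) (Im z),
   Derive (fun t : R => Im (f (Re z, t))) (Im z)).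

Definition dz (f : C -> C) (z : C) : C := ((d_xi f z - Ci * d_eta f z) / 2)%C.
Definition dzbar (f : C -> C) (z : C) : C := ((d_xi f z + Ci * d_eta f z) / 2)%C.

(* [Derive] is total, so the existence of the partial derivatives has to be
   required separately. *)
Definition has_partials (f : C -> C) (z : C) : Prop :=
  ex_derive (fun t : R => Re (f (t, Im z))) (Re z) /\
  ex_derive (fun t : R => Im (f (t, Im z))) (Re z) /\
  ex_derive (fun t : R => Re (f (Re z, t))) (Im z) /\
  ex_derive (fun t : R => Im (f (Re z, t))) (Im z).

Fixpoint Ck (k : nat) (D : C -> Prop) (f : C -> C) : Prop :=
  (forall z, D z -> continuous f z) /\
  match k with
  | O => True
  | S k' => (forall z, D z -> has_partials f z) /\ Ck k' D (d_xi f) /\ Ck k' D (d_eta f)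
  end.

Definition smooth (D : C -> Prop) (f : C -> C) : Prop := forall k : nat, Ck k D f.

Definition smooth_real (D : C -> Prop) (g : C -> R) : Prop :=
  smooth D (fun z => RtoC (g z)).

Definition image (D : C -> Prop) (f : C -> C) (w : C) : Prop :=
  exists z, D z /\ w = f z.

Definition injective_on (D : C -> Prop) (f : C -> C) : Prop :=
  forall z1 z2, D z1 -> D z2 -> f z1 = f z2 -> z1 = z2.

(* [is_derive] and [ex_derive] at [C_AbsRing] are complex differentiability. *)
Definition holomorphic (D : C -> Prop) (f : C -> C) : Prop :=
  open D /\ forall z, D z -> ex_derive (K := C_AbsRing) (V := C_NormedModule) f z.

(* [f] maps [D] biholomorphically onto its image. *)
Definition biholomorphic (D : C -> Prop) (f : C -> C) : Prop :=
  holomorphic D f /\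
  exists g : C -> C, holomorphic (image D f) g /\ forall z, D z -> g (f z) = z.

Definition diffeomorphism (D W : C -> Prop) (f : C -> C) : Prop :=
  open D /\ open W /\ smooth D f /\ (forall w, W w <-> image D f w) /\
  exists g : C -> C, smooth W g /\ forall z, D z -> g (f z) = z.

(* Jacobian determinant of [f] as a map of the real plane. *)
Definition jacobian (f : C -> C) (z : C) : R := Cmod (dz f z) ^ 2 - Cmod (dzbar f z) ^ 2.

Definition cexp (z : C) : C := (exp (Re z) * cos (Im z), exp (Re z) * sin (Im z)).

Definition sinh_gordon (K : R) (D : C -> Prop) (omega : C -> R) : Prop :=
  forall z, D z ->
    dzbar (dz (fun p => RtoC (omega p))) z = RtoC (- (K / 2) * sinh (2 * omega z)).

Definition beltrami (omega : C -> R) (D : C -> Prop) (u : C -> C) : Prop :=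
  forall z, D z ->
    dz u z <> RtoC 0 /\ (dzbar u z / dz u z)%C = RtoC (exp (- 2 * omega z)).

(* The target surface is an open set [W] of the plane, with coordinate [w] and
   metric [exp(F) |dw|^2]. *)
Definition harmonic (F : C -> R) (D : C -> Prop) (U : C -> C) : Prop :=
  forall z, D z ->
    (dzbar (dz U) z + dz (fun w => RtoC (F w)) (U z) * dz U z * dzbar U z)%C = RtoC 0.

Definition gauss_curvature (F : C -> R) (w : C) : C :=
  (- (2) * dzbar (dz (fun p => RtoC (F p))) w * RtoC (exp (- F w)))%C.

Definition constant_curvature (K : R) (W : C -> Prop) (F : C -> R) : Prop :=
  forall w, W w -> gauss_curvature F w = RtoC K.

(* Coefficient of the Hopf differential in the coordinate in which the map is
   written. *)
Definition hopf (F : C -> R) (V : C -> C) (z : C) : C :=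
  (RtoC (exp (F (V z))) * dz V z * dz (fun p => Cconj (V p)) z)%C.

(* The coordinate zeta on [Omega] is the special one of the map [U].  Here [D] is the
   range of another isothermal coordinate z on the same piece of the source surface,
   [Z] is the change of variable z |-> zeta, a primitive of exp(-lambda/2), and
   [fun z => U (Z z)] is the map written in the coordinate z. *)
Definition hopf_coordinate (F : C -> R) (Omega : C -> Prop) (U : C -> C) : Prop :=
  exists (D : C -> Prop) (lambda Z : C -> C),
    holomorphic D lambda /\
    (forall z, D z ->
       is_derive (K := C_AbsRing) (V := C_NormedModule) Z z (cexp (- lambda z / 2))) /\
    injective_on D Z /\
    (forall zeta, Omega zeta <-> image D Z zeta) /\
    (forall z, D z -> hopf F (fun p => U (Z p)) z = cexp (- lambda z)).

(* Harmonic map from [Omega] onto the surface [(W, exp(F) |dw|^2)], written in its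
   special coordinate; a local diffeomorphism, not necessarily injective. *)
Definition harmonic_immersion
    (F : C -> R) (Omega W : C -> Prop) (U : C -> C) : Prop :=
  open Omega /\ open W /\ smooth_real W F /\ smooth Omega U /\
  (forall w, W w <-> image Omega U w) /\
  (forall zeta, Omega zeta -> jacobian U zeta <> 0) /\
  harmonic F Omega U /\ hopf_coordinate F Omega U.

Definition harmonic_diffeomorphism
    (F : C -> R) (Omega W : C -> Prop) (U : C -> C) : Prop :=
  diffeomorphism Omega W U /\ smooth_real W F /\
  harmonic F Omega U /\ hopf_coordinate F Omega U.

Definition holomorphic_function_of (V : C -> Prop) (u U : C -> C) : Prop :=
  exists f : C -> C, holomorphic (image V u) f /\ forall z, V z -> U z = f (u z).

(* Main.v *)
Require Import Defs.
From Stdlib Require Import Reals Lra Lia ClassicalEpsilon.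
From Coquelicot Require Import Coquelicot.
Open Scope R_scope.

(* Two maps u, U with the same Beltrami coefficient m = exp(-2 omega) differ by a
   holomorphic factor: U o u^-1 has zbar-derivative (u_z U_zbar - u_zbar U_z) / jac u = 0.
   In the special coordinate the Hopf differential is 1, that is e^F |U_z|^2 m = 1, so F
   is determined along U by omega and U_z.  With p = F_w o U the harmonic map equation
   becomes p U_z^2 = 2 omega_z U_z - U_zz, and applying d/dzbar - m d/dz to it gives
   (1 - m^2) |U_z|^2 F_{w wbar}(U) = 2 omega_{z zbar}: together with the Hopf normalization
   this says K(U) sinh(2 omega) = -2 omega_{z zbar}, where K is the curvature of e^F |dw|^2.
   For the converse, F := (2 omega - ln |U_z|^2) o U^-1 is a metric making U harmonic. *)

(** * Real differentiability in Wirtinger form *)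

(** The operator d/dzbar - m d/dz annihilates every holomorphic function of U: on G o U it gives (1
    - m^2) conj(U_z) G_wbar(U), so on p = F_w o U it isolates F_{w wbar}. Up to the factor |U_z|^2,
    1 - m^2 is also the Jacobian of any solution of the Beltrami equation. Nondegeneracy is
    therefore a condition on omega alone (omega <> 0): it passes from U to u and justifies the
    division by sinh(2 omega). Since u may fail to be injective, the factorization of an immersion
    is local, on discs where u is invertible. The definitions speak of separate real partial
    derivatives, whose mere existence gives no chain rule. The working notion is therefore real
    differentiability with a linear approximation, which C^1 functions are shown to have; inverting
    maps then takes an inverse function theorem with smoothness of the inverse. Holomorphy is bare
    complex differentiability, and no integral theory enters: smoothness of an inverse is
    bootstrapped from its continuity. *)

Lemma locally_box (z : C) (P : C -> Prop) :
  locally z P <->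
  exists d : R, 0 < d /\
    forall y : C, Rabs (Re y - Re z) < d -> Rabs (Im y - Im z) < d -> P y.
Proof.
split.
- intros [d Hd]. exists d. split. apply cond_pos.
  intros y H1 H2. apply Hd. split; assumption.
- intros [d [d0 Hd]]. exists (mkposreal d d0). intros y [H1 H2]. apply Hd; assumption.
Qed.

Lemma im_le_Cmod (c : C) : Rabs (Im c) <= Cmod c.
Proof. exact (Rle_trans _ _ _ (Rmax_r _ _) (Rmax_Cmod c)). Qed.

Lemma Cmod_le_Re_Im (c : C) : Cmod c <= Rabs (Re c) + Rabs (Im c).
Proof.
replace c with (RtoC (Re c) + Ci * RtoC (Im c))%C at 1
  by (apply injective_projections; simpl; unfold Re, Im; ring).
eapply Rle_trans; [apply Cmod_triangle|].
rewrite Cmod_mult, Cmod_Ci, !Cmod_R. lra.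
Qed.

Lemma locally_Cmod (z : C) (P : C -> Prop) :
  locally z P <-> exists d : R, 0 < d /\ forall y : C, Cmod (y - z) < d -> P y.
Proof.
rewrite locally_box. split; intros [d [d0 Hd]].
- exists d. split; [assumption|]. intros y Hy.
  pose proof (re_le_Cmod (y - z)) as H1. pose proof (im_le_Cmod (y - z)) as H2.
  change (Rabs (Re y - Re z) <= Cmod (y - z)) in H1.
  change (Rabs (Im y - Im z) <= Cmod (y - z)) in H2.
  apply Hd; lra.
- exists (d / 2). split; [lra|]. intros y H1 H2. apply Hd.
  pose proof (Cmod_le_Re_Im (y - z)) as H.
  change (Cmod (y - z) <= Rabs (Re y - Re z) + Rabs (Im y - Im z)) in H. lra.
Qed.

Lemma continuous_Cmod (f : C -> C) (z : C) :
  continuous f z <->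
  forall eps : R, 0 < eps -> locally z (fun y => Cmod (f y - f z) < eps).
Proof.
split.
- intros H eps He.
  apply (H (fun w => Cmod (w - f z) < eps)). apply locally_Cmod. exists eps. auto.
- intros H P HP. apply locally_Cmod in HP. destruct HP as [d [d0 Hd]].
  unfold filtermap. apply filter_imp with (2 := H d d0). intros y Hy. apply Hd, Hy.
Qed.

(* Real differentiability of [f] at [z], with Wirtinger derivatives
   [a] = f_z and [b] = f_zbar. *)
Definition cdiff (f : C -> C) (z a b : C) : Prop :=
  forall eps : R, 0 < eps ->
    locally z (fun y =>
      Cmod (f y - f z - a * (y - z) - b * Cconj (y - z)) <= eps * Cmod (y - z)).

Lemma cdiff_ext_loc (f g : C -> C) (z a b : C) :
  locally z (fun y => f y = g y) -> cdiff f z a b -> cdiff g z a b.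
Proof.
intros E H eps He. pose proof (locally_singleton _ _ E) as Ez.
apply filter_imp with (2 := filter_and _ _ E (H eps He)).
intros y [Ey Hy]. rewrite <- Ez, <- Ey. exact Hy.
Qed.

Lemma cdiff_lip (f : C -> C) (z a b : C) :
  cdiff f z a b ->
  locally z (fun y => Cmod (f y - f z) <= (Cmod a + Cmod b + 1) * Cmod (y - z)).
Proof.
intros H. apply filter_imp with (2 := H 1 Rlt_0_1). intros y Hy.
replace (f y - f z)%C
  with ((f y - f z - a * (y - z) - b * Cconj (y - z)) + (a * (y - z) + b * Cconj (y - z)))%C
  by ring.
eapply Rle_trans; [apply Cmod_triangle|].
pose proof (Cmod_triangle (a * (y - z)) (b * Cconj (y - z))) as T.
rewrite !Cmod_mult, Cmod_conj in T. lra.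
Qed.

Lemma cdiff_continuous (f : C -> C) (z a b : C) : cdiff f z a b -> continuous f z.
Proof.
intros H. apply continuous_Cmod. intros eps He.
assert (HM : 0 < Cmod a + Cmod b + 1)
  by (pose proof (Cmod_ge_0 a); pose proof (Cmod_ge_0 b); lra).
assert (HL : locally z (fun y => Cmod (y - z) < eps / (Cmod a + Cmod b + 1))).
{ apply locally_Cmod. eexists. split; [|intros y Hy; exact Hy].
  apply Rdiv_lt_0_compat; assumption. }
apply filter_imp with (2 := filter_and _ _ (cdiff_lip _ _ _ _ H) HL).
intros y [H1 H2]. eapply Rle_lt_trans; [exact H1|].
apply Rmult_lt_compat_l with (r := Cmod a + Cmod b + 1) in H2; [|assumption].
replace ((Cmod a + Cmod b + 1) * (eps / (Cmod a + Cmod b + 1))) with eps in H2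
  by (field; lra). exact H2.
Qed.

Lemma cdiff_comp (f g : C -> C) (z A B a b : C) :
  cdiff f (g z) A B -> cdiff g z a b ->
  cdiff (fun y => f (g y)) z (A * a + B * Cconj b) (A * b + B * Cconj a).
Proof.
intros Hf Hg eps He.
pose proof (Cmod_ge_0 a). pose proof (Cmod_ge_0 b).
pose proof (Cmod_ge_0 A). pose proof (Cmod_ge_0 B).
set (M := Cmod a + Cmod b + 1). set (N := Cmod A + Cmod B + 1).
assert (M0 : 0 < M) by (unfold M; lra). assert (N0 : 0 < N) by (unfold N; lra).
(* [M] bounds the growth of [g] and [N] the effect of its remainder after [f]; each of the two
   remainders receives half of [eps]. *)
assert (E1 : 0 < eps / (2 * M)) by (apply Rdiv_lt_0_compat; lra).
assert (E2 : 0 < eps / (2 * N)) by (apply Rdiv_lt_0_compat; lra).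
pose proof (cdiff_continuous _ _ _ _ Hg _ (Hf _ E1)) as HL. unfold filtermap in HL.
apply filter_imp with
  (2 := filter_and _ _ HL (filter_and _ _ (cdiff_lip _ _ _ _ Hg) (Hg _ E2))).
intros y [K1 [K2 K3]]. fold M in K2.
set (e := (g y - g z - a * (y - z) - b * Cconj (y - z))%C) in *.
set (e1 := (f (g y) - f (g z) - A * (g y - g z) - B * Cconj (g y - g z))%C) in *.
replace (f (g y) - f (g z) - (A * a + B * Cconj b) * (y - z)
   - (A * b + B * Cconj a) * Cconj (y - z))%C with (e1 + (A * e + B * Cconj e))%C.
2:{ unfold e1, e. rewrite !Cminus_conj, !Cmult_conj, !Cminus_conj, !Cconj_conj. ring. }
eapply Rle_trans; [apply Cmod_triangle|].
pose proof (Cmod_triangle (A * e) (B * Cconj e)) as T.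
rewrite !Cmod_mult, Cmod_conj in T.
pose proof (Cmod_ge_0 (y - z)). pose proof (Cmod_ge_0 e).
assert (K4 : Cmod e1 <= eps / 2 * Cmod (y - z)).
{ eapply Rle_trans; [exact K1|].
  apply Rmult_le_compat_l with (r := eps / (2 * M)) in K2; [|lra].
  replace (eps / (2 * M) * (M * Cmod (y - z))) with (eps / 2 * Cmod (y - z)) in K2
    by (field; lra). exact K2. }
assert (K5 : N * Cmod e <= eps / 2 * Cmod (y - z)).
{ apply Rmult_le_compat_l with (r := N) in K3; [|lra].
  replace (N * (eps / (2 * N) * Cmod (y - z))) with (eps / 2 * Cmod (y - z)) in K3
    by (field; lra). exact K3. }
unfold N in K5. lra.
Qed.

Lemma cdiff_linear (z a b c : C) : cdiff (fun y => a * y + b * Cconj y + c)%C z a b.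
Proof.
intros eps He. apply filter_forall. intros y.
match goal with |- Cmod ?x <= _ => replace x with (RtoC 0) end.
2:{ rewrite !Cminus_conj. ring. }
rewrite Cmod_0. apply Rmult_le_pos; [lra|apply Cmod_ge_0].
Qed.

Lemma cdiff_const (c z : C) : cdiff (fun _ => c) z 0 0.
Proof.
apply cdiff_ext_loc with (2 := cdiff_linear z 0 0 c).
apply filter_forall. intros y. ring.
Qed.

Lemma cdiff_id (z : C) : cdiff (fun y => y) z 1 0.
Proof.
apply cdiff_ext_loc with (2 := cdiff_linear z 1 0 0).
apply filter_forall. intros y. ring.
Qed.

Lemma cdiff_plus (f g : C -> C) (z a b a' b' : C) :
  cdiff f z a b -> cdiff g z a' b' ->
  cdiff (fun y => f y + g y)%C z (a + a') (b + b').
Proof.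
intros Hf Hg eps He. assert (He2 : 0 < eps / 2) by lra.
apply filter_imp with (2 := filter_and _ _ (Hf _ He2) (Hg _ He2)).
intros y [H1 H2].
match goal with |- Cmod ?x <= _ => replace x with
 ((f y - f z - a * (y - z) - b * Cconj (y - z))
  + (g y - g z - a' * (y - z) - b' * Cconj (y - z)))%C by ring end.
eapply Rle_trans; [apply Cmod_triangle|]. lra.
Qed.

Lemma cdiff_eq (f : C -> C) (z a b a' b' : C) :
  cdiff f z a b -> a = a' -> b = b' -> cdiff f z a' b'.
Proof. intros H -> ->. exact H. Qed.

Lemma cdiff_conj (f : C -> C) (z a b : C) :
  cdiff f z a b -> cdiff (fun y => Cconj (f y)) z (Cconj b) (Cconj a).
Proof.
intros H.
apply cdiff_ext_loc with (fun y => 0 * f y + 1 * Cconj (f y) + 0)%C.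
- apply filter_forall. intros y. ring.
- eapply cdiff_eq.
  + exact (cdiff_comp (fun w => 0 * w + 1 * Cconj w + 0)%C f z _ _ _ _
      (cdiff_linear _ _ _ _) H).
  + ring.
  + ring.
Qed.

Lemma cdiff_scal (f : C -> C) (c z a b : C) :
  cdiff f z a b -> cdiff (fun y => c * f y)%C z (c * a) (c * b).
Proof.
intros H.
apply cdiff_ext_loc with (fun y => c * f y + 0 * Cconj (f y) + 0)%C.
- apply filter_forall. intros y. ring.
- eapply cdiff_eq.
  + exact (cdiff_comp (fun w => c * w + 0 * Cconj w + 0)%C f z _ _ _ _
      (cdiff_linear _ _ _ _) H).
  + ring.
  + ring.
Qed.

Lemma cdiff_minus (f g : C -> C) (z a b a' b' : C) :
  cdiff f z a b -> cdiff g z a' b' ->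
  cdiff (fun y => f y - g y)%C z (a - a') (b - b').
Proof.
intros Hf Hg.
apply cdiff_ext_loc with (fun y => f y + (-(1)) * g y)%C.
- apply filter_forall. intros y. ring.
- eapply cdiff_eq.
  + exact (cdiff_plus _ _ _ _ _ _ _ Hf (cdiff_scal _ (-(1)) _ _ _ Hg)).
  + ring.
  + ring.
Qed.

Lemma cdiff_square (z : C) : cdiff (fun y => y * y)%C z (2 * z) 0.
Proof.
intros eps He. apply locally_Cmod. exists eps. split; [exact He|]. intros y Hy.
match goal with |- Cmod ?x <= _ => replace x with ((y - z) * (y - z))%C by ring end.
rewrite Cmod_mult. pose proof (Cmod_ge_0 (y - z)). nra.
Qed.

(* Polarization reduces products to squares. *)
Lemma cdiff_mult (f g : C -> C) (z a b a' b' : C) :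
  cdiff f z a b -> cdiff g z a' b' ->
  cdiff (fun y => f y * g y)%C z (a * g z + f z * a') (b * g z + f z * b').
Proof.
intros Hf Hg.
pose proof (cdiff_comp _ _ _ _ _ _ _ (cdiff_square _) (cdiff_plus _ _ _ _ _ _ _ Hf Hg)) as H1.
pose proof (cdiff_comp _ _ _ _ _ _ _ (cdiff_square _) (cdiff_minus _ _ _ _ _ _ _ Hf Hg)) as H2.
pose proof (cdiff_scal _ (/ 4)%C _ _ _ (cdiff_minus _ _ _ _ _ _ _ H1 H2)) as H3.
simpl in H3.
eapply cdiff_eq.
- refine (cdiff_ext_loc _ _ _ _ _ _ H3). apply filter_forall. intros y. field.
- field.
- field.
Qed.

Lemma is_derive_R_iff (f : R -> R) (x l : R) :
  is_derive f x l <->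
  forall eps : R, 0 < eps ->
    locally x (fun y => Rabs (f y - f x - (y - x) * l) <= eps * Rabs (y - x)).
Proof.
split.
- intros [_ H] eps He. exact (H x (fun P HP => HP) (mkposreal eps He)).
- intros H. split; [apply is_linear_scal_l|].
  intros x' Hx. apply (is_filter_lim_locally_unique (V := AbsRing_NormedModule R_AbsRing)) in Hx. subst x'.
  intros eps. exact (H eps (cond_pos eps)).
Qed.

(** The vanishing zbar-derivative is the Cauchy-Riemann equation. Every holomorphy hypothesis enters
    the calculus, and every holomorphy claim leaves it, through this equivalence. *)
Lemma is_derive_C_iff (f : C -> C) (z l : C) :
  is_derive (K := C_AbsRing) (V := C_NormedModule) f z l <-> cdiff f z l 0.
Proof.
split.
(* Two uniform structures on the plane meet here: discs of the absolute value for [is_derive], boxes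
   of the product for [cdiff]. *)
- intros [_ H] eps He. apply locally_C.
  apply filter_imp with (2 := H z (fun P HP => HP) (mkposreal eps He)).
  intros y Hy.
  match goal with |- Cmod ?u <= _ => replace u with (f y - f z - (y - z) * l)%C by ring end.
  exact Hy.
- intros H. split; [apply is_linear_scal_l|].
  intros x' Hx. apply (is_filter_lim_locally_unique (V := AbsRing_NormedModule C_AbsRing)) in Hx. subst x'.
  intros eps. apply (proj1 (locally_C _ _)).
  apply filter_imp with (2 := H eps (cond_pos eps)).
  intros y Hy.
  match type of Hy with Cmod ?u <= _ => replace u with (f y - f z - (y - z) * l)%C in Hy by ring end.
  exact Hy.
Qed.

Lemma locally_line (z e : C) (P : C -> Prop) (s : R) :
  locally z P -> locally s (fun t => P (z + RtoC (t - s) * e)%C).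
Proof.
intros H. apply locally_Cmod in H. destruct H as [d [d0 Hd]].
pose proof (Cmod_ge_0 e) as He.
assert (Hd' : 0 < d / (Cmod e + 1)) by (apply Rdiv_lt_0_compat; lra).
exists (mkposreal _ Hd'). intros t Ht. apply Hd.
replace (z + RtoC (t - s) * e - z)%C with (RtoC (t - s) * e)%C by ring.
rewrite Cmod_mult, Cmod_R. change (Rabs (t - s) < d / (Cmod e + 1)) in Ht.
pose proof (Rabs_pos (t - s)).
apply Rmult_lt_compat_r with (r := Cmod e + 1) in Ht; [|lra].
unfold Rdiv in Ht. rewrite Rmult_assoc, Rinv_l, Rmult_1_r in Ht by lra. lra.
Qed.

(** The directions [e = 1] and [e = Ci] yield the two partial derivatives; the shift by [s] lets the
    parameter be the coordinate itself. *)
Lemma cdiff_line (f : C -> C) (z a b e : C) (s : R) :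
  cdiff f z a b ->
  is_derive (fun t : R => Re (f (z + RtoC (t - s) * e)%C)) s (Re (a * e + b * Cconj e)) /\
  is_derive (fun t : R => Im (f (z + RtoC (t - s) * e)%C)) s (Im (a * e + b * Cconj e)).
Proof.
intros H. pose proof (Cmod_ge_0 e) as He.
assert (Hz : (z + RtoC (s - s) * e)%C = z)
  by (apply injective_projections; simpl; ring).
assert (K : forall eps : R, 0 < eps -> locally s (fun t =>
  Cmod (f (z + RtoC (t - s) * e) - f (z + RtoC (s - s) * e)
         - RtoC (t - s) * (a * e + b * Cconj e))%C <= eps * Rabs (t - s))).
{ intros eps He0.
  assert (Hq : 0 < eps / (Cmod e + 1)) by (apply Rdiv_lt_0_compat; lra).
  apply filter_imp with (2 := locally_line z e _ s (H _ Hq)).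
  intros t Ht. rewrite Hz.
  match type of Ht with Cmod ?u <= _ => match goal with |- Cmod ?v <= _ =>
    replace v with u end end.
  - eapply Rle_trans; [exact Ht|].
    replace (z + RtoC (t - s) * e - z)%C with (RtoC (t - s) * e)%C by ring.
    rewrite Cmod_mult, Cmod_R.
    replace (eps * Rabs (t - s)) with (eps / (Cmod e + 1) * (Rabs (t - s) * (Cmod e + 1)))
      by (field; lra).
    apply Rmult_le_compat_l; [lra|].
    apply Rmult_le_compat_l; [apply Rabs_pos|lra].
  - replace (z + RtoC (t - s) * e - z)%C with (RtoC (t - s) * e)%C by ring.
    rewrite Cmult_conj.
    replace (Cconj (RtoC (t - s))) with (RtoC (t - s))
      by (apply injective_projections; simpl; ring).
    ring. }
split; apply is_derive_R_iff; intros eps He0;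
  apply filter_imp with (2 := K eps He0); intros t Ht;
  (eapply Rle_trans; [|exact Ht]).
- eapply Rle_trans; [|apply re_le_Cmod]. apply Req_le. f_equal.
  unfold Re, RtoC, Cminus, Cplus, Copp, Cmult. simpl. ring.
- eapply Rle_trans; [|apply im_le_Cmod]. apply Req_le. f_equal.
  unfold Im, RtoC, Cminus, Cplus, Copp, Cmult. simpl. ring.
Qed.

Lemma line_xi (z : C) (t : R) : (z + RtoC (t - Re z) * 1)%C = (t, Im z).
Proof. apply injective_projections; simpl; unfold Re, Im; ring. Qed.

Lemma line_eta (z : C) (t : R) : (z + RtoC (t - Im z) * Ci)%C = (Re z, t).
Proof. apply injective_projections; simpl; unfold Re, Im; ring. Qed.

Lemma cdiff_is_derive_partials (f : C -> C) (z a b : C) :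
  cdiff f z a b ->
  is_derive (fun t : R => Re (f (t, Im z))) (Re z) (Re (a + b)%C) /\
  is_derive (fun t : R => Im (f (t, Im z))) (Re z) (Im (a + b)%C) /\
  is_derive (fun t : R => Re (f (Re z, t))) (Im z) (Re (Ci * (a - b))%C) /\
  is_derive (fun t : R => Im (f (Re z, t))) (Im z) (Im (Ci * (a - b))%C).
Proof.
intros H.
destruct (cdiff_line f z a b 1 (Re z) H) as [H1 H2].
destruct (cdiff_line f z a b Ci (Im z) H) as [H3 H4].
replace (a * 1 + b * Cconj 1)%C with (a + b)%C in H1, H2
  by (apply injective_projections; simpl; ring).
replace (a * Ci + b * Cconj Ci)%C with (Ci * (a - b))%C in H3, H4
  by (apply injective_projections; simpl; ring).
refine (conj _ (conj _ (conj _ _)));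
  [apply is_derive_ext with (2 := H1) | apply is_derive_ext with (2 := H2)
  |apply is_derive_ext with (2 := H3) | apply is_derive_ext with (2 := H4)];
  intros t; rewrite ?line_xi, ?line_eta; reflexivity.
Qed.

Lemma cdiff_has_partials (f : C -> C) (z a b : C) : cdiff f z a b -> has_partials f z.
Proof.
intros H. destruct (cdiff_is_derive_partials _ _ _ _ H) as (H1 & H2 & H3 & H4).
refine (conj _ (conj _ (conj _ _))); eexists; eassumption.
Qed.

Lemma cdiff_d_xi (f : C -> C) (z a b : C) : cdiff f z a b -> d_xi f z = (a + b)%C.
Proof.
intros H. destruct (cdiff_is_derive_partials _ _ _ _ H) as (H1 & H2 & H3 & H4).
unfold d_xi. rewrite (is_derive_unique _ _ _ H1), (is_derive_unique _ _ _ H2).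
apply injective_projections; reflexivity.
Qed.

Lemma cdiff_d_eta (f : C -> C) (z a b : C) : cdiff f z a b -> d_eta f z = (Ci * (a - b))%C.
Proof.
intros H. destruct (cdiff_is_derive_partials _ _ _ _ H) as (H1 & H2 & H3 & H4).
unfold d_eta. rewrite (is_derive_unique _ _ _ H3), (is_derive_unique _ _ _ H4).
apply injective_projections; reflexivity.
Qed.

Lemma cdiff_dz (f : C -> C) (z a b : C) : cdiff f z a b -> dz f z = a.
Proof.
intros H. unfold dz. rewrite (cdiff_d_xi _ _ _ _ H), (cdiff_d_eta _ _ _ _ H).
apply injective_projections; simpl; field.
Qed.

Lemma cdiff_dzbar (f : C -> C) (z a b : C) : cdiff f z a b -> dzbar f z = b.
Proof.
intros H. unfold dzbar. rewrite (cdiff_d_xi _ _ _ _ H), (cdiff_d_eta _ _ _ _ H).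
apply injective_projections; simpl; field.
Qed.

(** * From continuous partial derivatives to differentiability *)

Lemma mean_value_bound (g dg : R -> R) (x y p eps : R) :
  (forall t : R, Rmin x y <= t <= Rmax x y ->
     is_derive g t (dg t) /\ Rabs (dg t - p) <= eps) ->
  Rabs (g y - g x - p * (y - x)) <= eps * Rabs (y - x).
Proof.
intros H. destruct (MVT_gen g x y dg) as (c & Hc & E).
- intros t Ht. apply H. lra.
- intros t Ht. apply derivable_continuous_pt. exists (dg t).
  apply is_derive_Reals, H, Ht.
- rewrite E. replace (dg c * (y - x) - p * (y - x)) with ((dg c - p) * (y - x)) by ring.
  rewrite Rabs_mult. apply Rmult_le_compat_r; [apply Rabs_pos|]. apply H, Hc.
Qed.

Lemma mean_value_bound_box (g gx gy : R -> R -> R) (x0 y0 r p q eps : R) :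
  (forall s t : R, Rabs (s - x0) < r -> Rabs (t - y0) < r ->
     is_derive (fun s => g s t) s (gx s t) /\ is_derive (fun t => g s t) t (gy s t) /\
     Rabs (gx s t - p) <= eps /\ Rabs (gy s t - q) <= eps) ->
  forall s t s' t' : R,
    Rabs (s - x0) < r -> Rabs (t - y0) < r -> Rabs (s' - x0) < r -> Rabs (t' - y0) < r ->
    Rabs (g s' t' - g s t - (p * (s' - s) + q * (t' - t)))
      <= eps * (Rabs (s' - s) + Rabs (t' - t)).
Proof.
assert (B : forall a b c x : R, Rabs (a - c) < r -> Rabs (b - c) < r ->
  Rmin a b <= x <= Rmax a b -> Rabs (x - c) < r).
{ intros a b c x. unfold Rmin, Rmax, Rabs.
  destruct (Rle_dec a b), (Rcase_abs (a - c)), (Rcase_abs (b - c)), (Rcase_abs (x - c)); lra. }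
intros H s t s' t' Hs Ht Hs' Ht'.
assert (H1 : Rabs (g s' t' - g s t' - p * (s' - s)) <= eps * Rabs (s' - s)).
{ apply (mean_value_bound (fun s => g s t') (fun s => gx s t')). intros x Hx.
  destruct (H x t') as (? & ? & ? & ?); [exact (B _ _ _ _ Hs Hs' Hx)|exact Ht'|auto]. }
assert (H2 : Rabs (g s t' - g s t - q * (t' - t)) <= eps * Rabs (t' - t)).
{ apply (mean_value_bound (fun t => g s t) (fun t => gy s t)). intros x Hx.
  destruct (H s x) as (? & ? & ? & ?); [exact Hs|exact (B _ _ _ _ Ht Ht' Hx)|auto]. }
(* The path turns at the corner [(s, t')], so that each leg changes one coordinate. *)
replace (g s' t' - g s t - (p * (s' - s) + q * (t' - t)))
  with ((g s' t' - g s t' - p * (s' - s)) + (g s t' - g s t - q * (t' - t))) by ring.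
eapply Rle_trans; [apply Rabs_triang|]. lra.
Qed.

(** Both points vary while the derivative stays frozen at [z0]. This uniformity is what makes the
    Newton map of the inverse function theorem a contraction; ordinary differentiability is the case
    [x = z0]. *)
Lemma strict_differentiability (D : C -> Prop) (f : C -> C) (z0 : C) :
  open D -> D z0 -> (forall z, D z -> has_partials f z) ->
  continuous (d_xi f) z0 -> continuous (d_eta f) z0 ->
  forall eps : R, 0 < eps ->
  exists r : R, 0 < r /\ forall x y : C, Cmod (x - z0) < r -> Cmod (y - z0) < r ->
    Cmod (f y - f x - dz f z0 * (y - x) - dzbar f z0 * Cconj (y - x))
      <= eps * Cmod (y - x).
Proof.
(* Four errors add up: real and imaginary part, each with two coordinate increments. *)
intros HD Hz0 Hp Cx Ce eps He. assert (He4 : 0 < eps / 4) by lra.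
pose proof (proj1 (continuous_Cmod _ _) Cx _ He4) as L1.
pose proof (proj1 (continuous_Cmod _ _) Ce _ He4) as L2.
destruct (proj1 (locally_box _ _) (filter_and _ _ (HD z0 Hz0) (filter_and _ _ L1 L2)))
  as (r & r0 & Hr).
exists r. split; [exact r0|]. intros x y Hx Hy.
assert (P : forall c : C, Cmod (c - z0) < r -> Rabs (Re c - Re z0) < r /\ Rabs (Im c - Im z0) < r).
{ intros c Hc. pose proof (re_le_Cmod (c - z0)) as H1. pose proof (im_le_Cmod (c - z0)) as H2.
  change (Rabs (Re c - Re z0) <= Cmod (c - z0)) in H1.
  change (Rabs (Im c - Im z0) <= Cmod (c - z0)) in H2. lra. }
destruct (P x Hx) as [X1 X2]. destruct (P y Hy) as [Y1 Y2].
assert (K : forall s t : R, Rabs (s - Re z0) < r -> Rabs (t - Im z0) < r ->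
  has_partials f (s, t) /\ Cmod (d_xi f (s, t) - d_xi f z0) <= eps / 4 /\
  Cmod (d_eta f (s, t) - d_eta f z0) <= eps / 4).
{ intros s t Hs Ht. destruct (Hr (s, t) Hs Ht) as (H1 & H2 & H3).
  split; [apply Hp, H1|lra]. }
assert (KR := mean_value_bound_box (fun s t => Re (f (s, t)))
  (fun s t => Re (d_xi f (s, t))) (fun s t => Re (d_eta f (s, t)))
  (Re z0) (Im z0) r (Re (d_xi f z0)) (Re (d_eta f z0)) (eps / 4)).
assert (KI := mean_value_bound_box (fun s t => Im (f (s, t)))
  (fun s t => Im (d_xi f (s, t))) (fun s t => Im (d_eta f (s, t)))
  (Re z0) (Im z0) r (Im (d_xi f z0)) (Im (d_eta f z0)) (eps / 4)).
lapply KR; [clear KR; intros KR|].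
2:{ intros s t Hs Ht. destruct (K s t Hs Ht) as ((P1 & P2 & P3 & P4) & H1 & H2).
  refine (conj _ (conj _ (conj _ _))).
  - exact (Derive_correct _ _ P1).
  - exact (Derive_correct _ _ P3).
  - exact (Rle_trans _ _ _ (re_le_Cmod (d_xi f (s, t) - d_xi f z0)) H1).
  - exact (Rle_trans _ _ _ (re_le_Cmod (d_eta f (s, t) - d_eta f z0)) H2). }
lapply KI; [clear KI; intros KI|].
2:{ intros s t Hs Ht. destruct (K s t Hs Ht) as ((P1 & P2 & P3 & P4) & H1 & H2).
  refine (conj _ (conj _ (conj _ _))).
  - exact (Derive_correct _ _ P2).
  - exact (Derive_correct _ _ P4).
  - exact (Rle_trans _ _ _ (im_le_Cmod (d_xi f (s, t) - d_xi f z0)) H1).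
  - exact (Rle_trans _ _ _ (im_le_Cmod (d_eta f (s, t) - d_eta f z0)) H2). }
specialize (KR _ _ _ _ X1 X2 Y1 Y2). specialize (KI _ _ _ _ X1 X2 Y1 Y2).
destruct x as [x1 x2], y as [y1 y2].
change (Re (x1, x2)) with x1 in *. change (Im (x1, x2)) with x2 in *.
change (Re (y1, y2)) with y1 in *. change (Im (y1, y2)) with y2 in *.
eapply Rle_trans; [apply Cmod_le_Re_Im|].
pose proof (re_le_Cmod ((y1, y2) - (x1, x2))%C) as M1.
pose proof (im_le_Cmod ((y1, y2) - (x1, x2))%C) as M2.
change (Rabs (y1 - x1) <= Cmod ((y1, y2) - (x1, x2))%C) in M1.
change (Rabs (y2 - x2) <= Cmod ((y1, y2) - (x1, x2))%C) in M2.
set (N := Cmod ((y1, y2) - (x1, x2))%C) in *.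
match type of KR with Rabs ?u <= _ => match goal with |- Rabs ?v + _ <= _ =>
  replace v with u by (unfold dz, dzbar, d_xi, d_eta, Re, Im; simpl; field) end end.
match type of KI with Rabs ?u <= _ => match goal with |- _ + Rabs ?v <= _ =>
  replace v with u by (unfold dz, dzbar, d_xi, d_eta, Re, Im; simpl; field) end end.
assert (eps / 4 * (Rabs (y1 - x1) + Rabs (y2 - x2)) <= eps / 4 * (2 * N))
  by (apply Rmult_le_compat_l; lra).
lra.
Qed.

Lemma C1_cdiff (D : C -> Prop) (f : C -> C) (z : C) :
  open D -> Ck 1 D f -> D z -> cdiff f z (dz f z) (dzbar f z).
Proof.
intros HD (_ & Hp & (Cx & _) & (Ce & _)) Hz eps He.
destruct (strict_differentiability D f z HD Hz Hp (Cx z Hz) (Ce z Hz) eps He)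
  as (r & r0 & Hr).
apply locally_Cmod. exists r. split; [exact r0|]. intros y Hy. apply Hr; [|exact Hy].
replace (z - z)%C with (RtoC 0) by ring. rewrite Cmod_0. exact r0.
Qed.

(** * Calculus of C^k functions *)

Lemma partials_ext_loc (f g : C -> C) (z : C) :
  locally z (fun y => f y = g y) ->
  d_xi f z = d_xi g z /\ d_eta f z = d_eta g z /\ (has_partials f z -> has_partials g z).
Proof.
intros H.
assert (Lx : locally (Re z) (fun t : R => f (t, Im z) = g (t, Im z))).
{ apply filter_imp with (2 := locally_line z 1 _ (Re z) H). intros t. rewrite line_xi. auto. }
assert (Le : locally (Im z) (fun t : R => f (Re z, t) = g (Re z, t))).
{ apply filter_imp with (2 := locally_line z Ci _ (Im z) H). intros t. rewrite line_eta. auto. }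
assert (M : forall (P : C -> R) (p : R -> C) (s : R),
  locally s (fun t : R => f (p t) = g (p t)) ->
  locally s (fun t : R => P (f (p t)) = P (g (p t)))).
{ intros P p s K. apply filter_imp with (2 := K). intros t ->. reflexivity. }
split; [|split].
- unfold d_xi. f_equal; apply Derive_ext_loc; [apply (M Re)|apply (M Im)]; exact Lx.
- unfold d_eta. f_equal; apply Derive_ext_loc; [apply (M Re)|apply (M Im)]; exact Le.
- intros (P1 & P2 & P3 & P4).
  refine (conj (ex_derive_ext_loc _ _ _ _ P1) (conj (ex_derive_ext_loc _ _ _ _ P2)
    (conj (ex_derive_ext_loc _ _ _ _ P3) (ex_derive_ext_loc _ _ _ _ P4)))).
  + exact (M Re _ _ Lx).
  + exact (M Im _ _ Lx).
  + exact (M Re _ _ Le).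
  + exact (M Im _ _ Le).
Qed.

Lemma Ck_ext (k : nat) (D : C -> Prop) (f g : C -> C) :
  open D -> (forall z, D z -> f z = g z) -> Ck k D f -> Ck k D g.
Proof.
intros HD. revert f g. induction k as [|k IH]; intros f g E [Hc Hk].
all: assert (L : forall z, D z -> locally z (fun y => f y = g y))
  by (intros z Hz; apply filter_imp with (2 := HD z Hz); exact E).
all: assert (Hc' : forall z, D z -> continuous g z)
  by (intros z Hz; apply (continuous_ext_loc g f); [exact (L z Hz)|exact (Hc z Hz)]).
- split; [exact Hc'|exact I].
- destruct Hk as (Hp & Hx & He). split; [exact Hc'|]. split; [|split].
  + intros z Hz. apply (partials_ext_loc f g z (L z Hz)), Hp, Hz.
  + apply (IH (d_xi f)); [|exact Hx]. intros z Hz. apply (partials_ext_loc f g z (L z Hz)).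
  + apply (IH (d_eta f)); [|exact He]. intros z Hz. apply (partials_ext_loc f g z (L z Hz)).
Qed.

Lemma Ck_pred (k : nat) (D : C -> Prop) (f : C -> C) : Ck (S k) D f -> Ck k D f.
Proof.
revert f. induction k as [|k IH]; intros f (Hc & Hp & Hx & He).
- split; [exact Hc|exact I].
- split; [exact Hc|]. split; [exact Hp|]. split; apply IH; assumption.
Qed.

Lemma Ck_0 (k : nat) (D : C -> Prop) (f : C -> C) : Ck k D f -> Ck 0 D f.
Proof. destruct k; intros [Hc _]; split; auto. Qed.

Lemma Ck_cdiff (k : nat) (D : C -> Prop) (f : C -> C) (z : C) :
  open D -> Ck (S k) D f -> D z -> cdiff f z (dz f z) (dzbar f z).
Proof.
intros HD (Hc & Hp & Hx & He). apply (C1_cdiff D); [exact HD|].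
split; [exact Hc|]. split; [exact Hp|]. split; eapply Ck_0; eassumption.
Qed.

(** The hypotheses concern the combinations [a + b] and [Ci * (a - b)] because closure under sums is
    itself proved from this lemma; the handier [Ck_S_intro] becomes available only afterwards. *)
Lemma Ck_S_partials (k : nat) (D : C -> Prop) (f a b : C -> C) :
  open D -> (forall z, D z -> cdiff f z (a z) (b z)) ->
  Ck k D (fun z => a z + b z)%C -> Ck k D (fun z => Ci * (a z - b z))%C -> Ck (S k) D f.
Proof.
intros HD H Hx He. split; [|split; [|split]].
- intros z Hz. exact (cdiff_continuous _ _ _ _ (H z Hz)).
- intros z Hz. exact (cdiff_has_partials _ _ _ _ (H z Hz)).
- apply Ck_ext with (3 := Hx); [exact HD|]. intros z Hz. symmetry.
  exact (cdiff_d_xi _ _ _ _ (H z Hz)).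
- apply Ck_ext with (3 := He); [exact HD|]. intros z Hz. symmetry.
  exact (cdiff_d_eta _ _ _ _ (H z Hz)).
Qed.

Lemma d_xi_eq (f : C -> C) (z : C) : d_xi f z = (dz f z + dzbar f z)%C.
Proof. unfold dz, dzbar. field. Qed.

Lemma d_eta_eq (f : C -> C) (z : C) : d_eta f z = (Ci * (dz f z - dzbar f z))%C.
Proof. apply injective_projections; unfold dz, dzbar; simpl; field. Qed.

Lemma Ck_plus (k : nat) (D : C -> Prop) (f g : C -> C) :
  open D -> Ck k D f -> Ck k D g -> Ck k D (fun z => f z + g z)%C.
Proof.
intros HD. revert f g. induction k as [|k IH]; intros f g Hf Hg.
- split; [|exact I]. intros z Hz.
  exact (continuous_plus (V := C_NormedModule) f g z (proj1 Hf z Hz) (proj1 Hg z Hz)).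
- pose proof Hf as (_ & _ & Hx & He). pose proof Hg as (_ & _ & Gx & Ge).
  apply Ck_S_partials with (a := fun z => (dz f z + dz g z)%C)
    (b := fun z => (dzbar f z + dzbar g z)%C); [exact HD| | |].
  + intros z Hz. apply cdiff_plus; eapply Ck_cdiff; eassumption.
  + apply Ck_ext with (3 := IH _ _ Hx Gx); [exact HD|]. intros z _.
    rewrite !d_xi_eq. ring.
  + apply Ck_ext with (3 := IH _ _ He Ge); [exact HD|]. intros z _.
    rewrite !d_eta_eq. ring.
Qed.

Lemma continuous_cdiff_comp (phi f : C -> C) (z a b : C) :
  cdiff phi (f z) a b -> continuous f z -> continuous (fun y => phi (f y)) z.
Proof.
intros H Hf. apply continuous_comp; [exact Hf|]. exact (cdiff_continuous _ _ _ _ H).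
Qed.

Lemma Ck_scal (k : nat) (D : C -> Prop) (c : C) (f : C -> C) :
  open D -> Ck k D f -> Ck k D (fun z => c * f z)%C.
Proof.
intros HD. revert f. induction k as [|k IH]; intros f Hf.
- split; [|exact I]. intros z Hz.
  refine (continuous_cdiff_comp (fun w => c * w)%C f z _ _ _ (proj1 Hf z Hz)).
  exact (cdiff_scal _ _ _ _ _ (cdiff_id _)).
- pose proof Hf as (_ & _ & Hx & He).
  apply Ck_S_partials with (a := fun z => (c * dz f z)%C)
    (b := fun z => (c * dzbar f z)%C); [exact HD| | |].
  + intros z Hz. apply cdiff_scal; eapply Ck_cdiff; eassumption.
  + apply Ck_ext with (3 := IH _ Hx); [exact HD|]. intros z _.
    rewrite !d_xi_eq. ring.
  + apply Ck_ext with (3 := IH _ He); [exact HD|]. intros z _.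
    rewrite !d_eta_eq. ring.
Qed.

Lemma Ck_minus (k : nat) (D : C -> Prop) (f g : C -> C) :
  open D -> Ck k D f -> Ck k D g -> Ck k D (fun z => f z - g z)%C.
Proof.
intros HD Hf Hg.
apply Ck_ext with (3 := Ck_plus _ _ _ _ HD Hf (Ck_scal _ _ (-(1))%C _ HD Hg)); [exact HD|].
intros z _. ring.
Qed.

Lemma Ck_S_intro (k : nat) (D : C -> Prop) (f a b : C -> C) :
  open D -> (forall z, D z -> cdiff f z (a z) (b z)) ->
  Ck k D a -> Ck k D b -> Ck (S k) D f.
Proof.
intros HD H Ha Hb. apply (Ck_S_partials k D f a b HD H).
- exact (Ck_plus _ _ _ _ HD Ha Hb).
- exact (Ck_scal _ _ _ _ HD (Ck_minus _ _ _ _ HD Ha Hb)).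
Qed.

Lemma Ck_dz (k : nat) (D : C -> Prop) (f : C -> C) :
  open D -> Ck (S k) D f -> Ck k D (dz f).
Proof.
intros HD (_ & _ & Hx & He).
apply Ck_ext with
  (3 := Ck_scal _ _ (/ 2)%C _ HD (Ck_minus _ _ _ _ HD Hx (Ck_scal _ _ Ci _ HD He)));
  [exact HD|].
intros z _. unfold dz. field.
Qed.

Lemma Ck_dzbar (k : nat) (D : C -> Prop) (f : C -> C) :
  open D -> Ck (S k) D f -> Ck k D (dzbar f).
Proof.
intros HD (_ & _ & Hx & He).
apply Ck_ext with
  (3 := Ck_scal _ _ (/ 2)%C _ HD (Ck_plus _ _ _ _ HD Hx (Ck_scal _ _ Ci _ HD He)));
  [exact HD|].
intros z _. unfold dzbar. field.
Qed.

Lemma Ck_mult (k : nat) (D : C -> Prop) (f g : C -> C) :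
  open D -> Ck k D f -> Ck k D g -> Ck k D (fun z => f z * g z)%C.
Proof.
intros HD. revert f g. induction k as [|k IH]; intros f g Hf Hg.
(* Polarization again: continuity of a product follows from that of squares. *)
- assert (Q : forall h, Ck 0 D h -> Ck 0 D (fun z => h z * h z)%C).
  { intros h Hh. split; [|exact I]. intros z Hz.
    exact (continuous_cdiff_comp (fun w => w * w)%C h z _ _ (cdiff_square _) (proj1 Hh z Hz)). }
  refine (Ck_ext _ _ _ _ HD _ (Ck_scal _ _ (/ 4)%C _ HD (Ck_minus _ _ _ _ HD
    (Q _ (Ck_plus _ _ _ _ HD Hf Hg)) (Q _ (Ck_minus _ _ _ _ HD Hf Hg))))).
  intros z _. cbv beta. field.
- apply Ck_S_intro with (a := fun z => (dz f z * g z + f z * dz g z)%C)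
    (b := fun z => (dzbar f z * g z + f z * dzbar g z)%C); [exact HD| | |].
  + intros z Hz. apply cdiff_mult; eapply Ck_cdiff; eassumption.
  + apply Ck_plus; [exact HD| |]; apply IH; auto using Ck_dz, Ck_pred.
  + apply Ck_plus; [exact HD| |]; apply IH; auto using Ck_dzbar, Ck_pred.
Qed.

Lemma Ck_conj (k : nat) (D : C -> Prop) (f : C -> C) :
  open D -> Ck k D f -> Ck k D (fun z => Cconj (f z)).
Proof.
intros HD. revert f. induction k as [|k IH]; intros f Hf.
- split; [|exact I]. intros z Hz.
  exact (continuous_cdiff_comp Cconj f z _ _ (cdiff_conj _ _ _ _ (cdiff_id _)) (proj1 Hf z Hz)).
- apply Ck_S_intro with (a := fun z => Cconj (dzbar f z))
    (b := fun z => Cconj (dz f z)); [exact HD| | |].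
  + intros z Hz. apply cdiff_conj; eapply Ck_cdiff; eassumption.
  + apply IH, Ck_dzbar; assumption.
  + apply IH, Ck_dz; assumption.
Qed.

Lemma Ck_comp (k : nat) (D D' : C -> Prop) (f g : C -> C) :
  open D -> open D' -> (forall z, D z -> D' (g z)) ->
  Ck k D' f -> Ck k D g -> Ck k D (fun z => f (g z)).
Proof.
intros HD HD' Hm. revert f g Hm. induction k as [|k IH]; intros f g Hm Hf Hg.
- split; [|exact I]. intros z Hz.
  apply continuous_comp; [exact (proj1 Hg z Hz)|exact (proj1 Hf _ (Hm z Hz))].
- assert (K : forall h, Ck k D' h -> Ck k D (fun z => h (g z)))
    by (intros h Hh; exact (IH h g Hm Hh (Ck_pred _ _ _ Hg))).
  apply Ck_S_intro
    with (a := fun z => (dz f (g z) * dz g z + dzbar f (g z) * Cconj (dzbar g z))%C)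
      (b := fun z => (dz f (g z) * dzbar g z + dzbar f (g z) * Cconj (dz g z))%C);
    [exact HD| | |].
  + intros z Hz. apply (cdiff_comp f g); [|exact (Ck_cdiff _ _ _ _ HD Hg Hz)].
    exact (Ck_cdiff _ _ _ _ HD' Hf (Hm z Hz)).
  + apply Ck_plus; [exact HD| |]; (apply Ck_mult; [exact HD| |]);
      auto using Ck_dz, Ck_dzbar, Ck_conj.
  + apply Ck_plus; [exact HD| |]; (apply Ck_mult; [exact HD| |]);
      auto using Ck_dz, Ck_dzbar, Ck_conj.
Qed.

Lemma Ck_const (k : nat) (D : C -> Prop) (c : C) : open D -> Ck k D (fun _ => c).
Proof.
intros HD. revert c. induction k as [|k IH]; intros c.
- split; [|exact I]. intros z _. exact (cdiff_continuous _ _ _ _ (cdiff_const c z)).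
- apply Ck_S_intro with (a := fun _ => RtoC 0) (b := fun _ => RtoC 0); auto.
  intros z _. apply cdiff_const.
Qed.

Lemma Ck_id (k : nat) (D : C -> Prop) : open D -> Ck k D (fun z => z).
Proof.
intros HD. destruct k as [|k].
- split; [|exact I]. intros z _. exact (cdiff_continuous _ _ _ _ (cdiff_id z)).
- apply Ck_S_intro with (a := fun _ => RtoC 1) (b := fun _ => RtoC 0);
    auto using Ck_const. intros z _. apply cdiff_id.
Qed.

(** * Reciprocal and logarithm *)

Lemma open_neq_0 : open (fun w : C => w <> 0).
Proof.
intros z Hz. apply locally_Cmod. exists (Cmod z). split; [apply Cmod_gt_0, Hz|].
intros y Hy E. subst y. replace (RtoC 0 - z)%C with (- z)%C in Hy by ring.
rewrite Cmod_opp in Hy. lra.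
Qed.

Lemma cdiff_inv (z : C) : z <> 0 -> cdiff Cinv z (- (/ z * / z))%C 0.
Proof.
intros Hz eps He. pose proof (proj1 (Cmod_gt_0 z) Hz) as Hm. set (m := Cmod z) in *.
assert (Hd : 0 < eps * (m * m * m) / 2)
  by (repeat apply Rmult_lt_0_compat; lra).
(* The remainder is (y - z)^2 / (y z^2). The first bound keeps |y| above m / 2, so the denominator
   exceeds m^3 / 2; the second then makes the quotient at most eps |y - z|. *)
apply locally_Cmod. exists (Rmin (m / 2) (eps * (m * m * m) / 2)).
split; [apply Rmin_glb_lt; lra|]. intros y Hy.
pose proof (Rlt_le_trans _ _ _ Hy (Rmin_l _ _)) as H1.
pose proof (Rlt_le_trans _ _ _ Hy (Rmin_r _ _)) as H2.
assert (Hy2 : m / 2 < Cmod y).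
{ pose proof (Cmod_triangle y (z - y)) as T.
  replace (y + (z - y))%C with z in T by ring. fold m in T.
  replace (z - y)%C with (- (y - z))%C in T by ring. rewrite Cmod_opp in T. lra. }
assert (Hy0 : y <> 0) by (apply Cmod_gt_0; lra).
match goal with |- Cmod ?u <= _ =>
  replace u with ((y - z) * ((y - z) * / (y * z * z)))%C by (field; auto) end.
rewrite Cmod_mult, Rmult_comm. apply Rmult_le_compat_r; [apply Cmod_ge_0|].
assert (Hyz : (y * z * z)%C <> 0) by (repeat apply Cmult_neq_0; assumption).
rewrite Cmod_mult, Cmod_inv, !Cmod_mult by assumption. fold m.
assert (P : m / 2 * m * m <= Cmod y * m * m)
  by (repeat apply Rmult_le_compat_r; lra).
assert (P0 : 0 < Cmod y * m * m) by (repeat apply Rmult_lt_0_compat; lra).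
apply Rmult_le_reg_r with (1 := P0). rewrite Rmult_assoc, Rinv_l by lra.
apply Rmult_le_compat_l with (r := eps) in P; lra.
Qed.

Lemma smooth_Cinv : smooth (fun w => w <> 0) Cinv.
Proof.
pose proof open_neq_0 as HO. intros k. induction k as [|k IH].
- split; [|exact I]. intros z Hz. exact (cdiff_continuous _ _ _ _ (cdiff_inv z Hz)).
- apply Ck_S_intro with (a := fun z => (- (1) * (/ z * / z))%C) (b := fun _ => RtoC 0).
  + exact HO.
  + intros z Hz. eapply cdiff_eq; [exact (cdiff_inv z Hz)|ring|reflexivity].
  + apply Ck_scal; [exact HO|]. apply Ck_mult; [exact HO| |]; exact IH.
  + apply Ck_const, HO.
Qed.

Lemma Ck_inv (k : nat) (D : C -> Prop) (f : C -> C) :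
  open D -> (forall z, D z -> f z <> 0) -> Ck k D f -> Ck k D (fun z => / f z)%C.
Proof.
intros HD H0 Hf. exact (Ck_comp k D _ Cinv f HD open_neq_0 H0 (smooth_Cinv k) Hf).
Qed.

(** Re w = (w + conj w) / 2 gives each Wirtinger derivative half of [l]. *)
Lemma cdiff_real_fun (phi : R -> R) (l : R) (z : C) :
  is_derive phi (Re z) l -> cdiff (fun w => RtoC (phi (Re w))) z (RtoC (l / 2)) (RtoC (l / 2)).
Proof.
intros H eps He. pose proof (proj1 (is_derive_R_iff _ _ _) H eps He) as [d Hd].
apply locally_Cmod. exists d. split; [apply cond_pos|]. intros y Hy.
pose proof (re_le_Cmod (y - z)) as K. change (Rabs (Re y - Re z) <= Cmod (y - z)) in K.
assert (Hb : Rabs (Re y - Re z) < d) by lra. specialize (Hd (Re y) Hb).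
match goal with |- Cmod ?u <= _ =>
  replace u with (RtoC (phi (Re y) - phi (Re z) - (Re y - Re z) * l))
    by (apply injective_projections; simpl; unfold Re; field) end.
rewrite Cmod_R. eapply Rle_trans; [exact Hd|]. apply Rmult_le_compat_l; lra.
Qed.

Lemma open_Re_pos : open (fun w : C => 0 < Re w).
Proof.
intros z Hz. apply locally_box. exists (Re z). split; [exact Hz|].
intros y Hy _. apply Rabs_def2 in Hy. lra.
Qed.

Lemma smooth_ln : smooth (fun w => 0 < Re w) (fun w => RtoC (ln (Re w))).
Proof.
pose proof open_Re_pos as HO.
assert (S : forall k, Ck (S k) (fun w => 0 < Re w) (fun w => RtoC (ln (Re w)))).
{ intros k.
  (* Both Wirtinger derivatives of ln(Re w) equal 1 / (2 Re w) = 1 / (w + conj w), a reciprocal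
     already known to be smooth. *)
  assert (K : Ck k (fun w => 0 < Re w) (fun w => / (w + Cconj w))%C).
  { apply Ck_inv; [exact HO| |].
    - intros w Hw E. apply (f_equal Re) in E. simpl in E. unfold Re in *. lra.
    - apply Ck_plus; [exact HO|apply Ck_id, HO|]. apply Ck_conj; [exact HO|apply Ck_id, HO]. }
  refine (Ck_S_intro k _ _ _ _ HO _ K K). intros z Hz.
  assert (E : RtoC (/ Re z / 2) = (/ (z + Cconj z))%C).
  { replace (z + Cconj z)%C with (RtoC (2 * Re z))
      by (apply injective_projections; simpl; unfold Re; ring).
    rewrite <- RtoC_inv by lra. f_equal. field. lra. }
  eapply cdiff_eq; [exact (cdiff_real_fun ln _ z (is_derive_ln _ Hz))|exact E|exact E]. }
intros k. apply Ck_pred, S.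
Qed.

(** * Symmetry of second derivatives *)

Lemma d_xi_d_eta (D : C -> Prop) (f : C -> C) (z : C) :
  open D -> Ck 2 D f -> D z -> d_xi (d_eta f) z = d_eta (d_xi f) z.
Proof.
intros HD (_ & Hp & (_ & Hpx & _ & (Cex & _)) & (_ & Hpe & (Cxe & _) & _)) Hz.
assert (L : forall P : R -> R -> Prop, (forall c, D c -> P (Re c) (Im c)) ->
  locally_2d P (Re z) (Im z)).
{ intros P HP. destruct (proj1 (locally_box _ _) (HD z Hz)) as (d & d0 & Hd).
  exists (mkposreal d d0). intros u v Hu Hv. exact (HP (u, v) (Hd (u, v) Hu Hv)). }
assert (Cont : forall (P : C -> R) (g : C -> C),
  (forall c c', Rabs (P c - P c') <= Cmod (c - c')) -> continuous g z ->
  continuity_2d_pt (fun u v => P (g (u, v))) (Re z) (Im z)).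
{ intros P g HP Hg eps.
  pose proof (proj1 (continuous_Cmod _ _) Hg eps (cond_pos eps)) as K.
  destruct (proj1 (locally_box _ _) K) as (d & d0 & Hd).
  exists (mkposreal d d0). intros u v Hu Hv. specialize (Hd (u, v) Hu Hv).
  rewrite <- surjective_pairing. eapply Rle_lt_trans; [apply HP|exact Hd]. }
assert (CR : forall c c' : C, Rabs (Re c - Re c') <= Cmod (c - c'))
  by (intros c c'; exact (re_le_Cmod (c - c'))).
assert (CI : forall c c' : C, Rabs (Im c - Im c') <= Cmod (c - c'))
  by (intros c c'; exact (im_le_Cmod (c - c'))).
apply injective_projections.
- change (Derive (fun x => Derive (fun t => Re (f (x, t))) (Im z)) (Re z)
    = Derive (fun y => Derive (fun t => Re (f (t, y))) (Re z)) (Im z)).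
  apply (Schwarz (fun x y => Re (f (x, y)))).
  + apply L. intros c Hc. destruct (Hp c Hc) as (A1 & A2 & A3 & A4).
    destruct (Hpx c Hc) as (B1 & B2 & B3 & B4). destruct (Hpe c Hc) as (E1 & E2 & E3 & E4).
    exact (conj A1 (conj A3 (conj E1 B3))).
  + exact (Cont Re _ CR (Cxe z Hz)).
  + exact (Cont Re _ CR (Cex z Hz)).
- change (Derive (fun x => Derive (fun t => Im (f (x, t))) (Im z)) (Re z)
    = Derive (fun y => Derive (fun t => Im (f (t, y))) (Re z)) (Im z)).
  apply (Schwarz (fun x y => Im (f (x, y)))).
  + apply L. intros c Hc. destruct (Hp c Hc) as (A1 & A2 & A3 & A4).
    destruct (Hpx c Hc) as (B1 & B2 & B3 & B4). destruct (Hpe c Hc) as (E1 & E2 & E3 & E4).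
    exact (conj A2 (conj A4 (conj E2 B4))).
  + exact (Cont Im _ CI (Cxe z Hz)).
  + exact (Cont Im _ CI (Cex z Hz)).
Qed.

(** Once the real partial derivatives commute, both sides are a quarter of the Laplacian. *)
Lemma dz_dzbar (D : C -> Prop) (f : C -> C) (z : C) :
  open D -> Ck 2 D f -> D z -> dz (dzbar f) z = dzbar (dz f) z.
Proof.
intros HD Hf Hz. pose proof (d_xi_d_eta D f z HD Hf Hz) as E.
pose proof Hf as (_ & _ & Hx & He).
pose proof (Ck_cdiff _ _ _ _ HD Hx Hz) as Dx. pose proof (Ck_cdiff _ _ _ _ HD He Hz) as De.
rewrite (cdiff_d_xi _ _ _ _ De), (cdiff_d_eta _ _ _ _ Dx) in E.
assert (H1 : cdiff (dzbar f) z (/ 2 * (dz (d_xi f) z + Ci * dz (d_eta f) z))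
  (/ 2 * (dzbar (d_xi f) z + Ci * dzbar (d_eta f) z))).
{ refine (cdiff_ext_loc _ _ _ _ _ _
    (cdiff_scal _ (/ 2)%C _ _ _ (cdiff_plus _ _ _ _ _ _ _ Dx (cdiff_scal _ Ci _ _ _ De)))).
  apply filter_forall. intros y. unfold dzbar. field. }
assert (H2 : cdiff (dz f) z (/ 2 * (dz (d_xi f) z - Ci * dz (d_eta f) z))
  (/ 2 * (dzbar (d_xi f) z - Ci * dzbar (d_eta f) z))).
{ refine (cdiff_ext_loc _ _ _ _ _ _
    (cdiff_scal _ (/ 2)%C _ _ _ (cdiff_minus _ _ _ _ _ _ _ Dx (cdiff_scal _ Ci _ _ _ De)))).
  apply filter_forall. intros y. unfold dz. field. }
rewrite (cdiff_dz _ _ _ _ H1), (cdiff_dzbar _ _ _ _ H2). f_equal.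
apply (f_equal (Cmult Ci)) in E.
assert (I2 : (Ci * Ci = - (1))%C) by (apply injective_projections; simpl; ring).
replace (Ci * (Ci * (dz (d_xi f) z - dzbar (d_xi f) z)))%C
  with (dzbar (d_xi f) z - dz (d_xi f) z)%C in E
  by (transitivity (Ci * Ci * (dz (d_xi f) z - dzbar (d_xi f) z))%C; [rewrite I2; ring|ring]).
replace (Ci * dz (d_eta f) z)%C
  with (Ci * (dz (d_eta f) z + dzbar (d_eta f) z) - Ci * dzbar (d_eta f) z)%C by ring.
rewrite E. ring.
Qed.

(** * Inverse function theorem *)

Lemma le_geometric_0 (u K : R) : (forall n : nat, u <= K * (/ 2) ^ n) -> u <= 0.
Proof.
intros H.
assert (L : is_lim_seq (fun n => K * (/ 2) ^ n) (K * 0)).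
{ apply (is_lim_seq_scal_l (fun n => (/ 2) ^ n) K 0), is_lim_seq_geom.
  rewrite Rabs_pos_eq; lra. }
rewrite Rmult_0_r in L.
exact (is_lim_seq_le _ _ (Finite u) (Finite 0) H (is_lim_seq_const u) L).
Qed.

Lemma geometric_limit_R (x : nat -> R) (d : R) :
  (forall n : nat, Rabs (x (S n) - x n) <= d * (/ 2) ^ n) ->
  exists l : R, forall n : nat, Rabs (x n - l) <= 2 * d * (/ 2) ^ n.
Proof.
intros H.
(* The right side is the exact sum of the steps d 2^-i for n <= i < n + m, so the induction closes
   without loss. *)
assert (B : forall n m : nat, Rabs (x (n + m)%nat - x n)
  <= 2 * d * (/ 2) ^ n - 2 * d * (/ 2) ^ (n + m)).
{ intros n m. induction m as [|m IH].
  - rewrite Nat.add_0_r, Rminus_diag, Rabs_R0. lra.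
  - rewrite Nat.add_succ_r. specialize (H (n + m)%nat). simpl.
    pose proof (Rabs_triang (x (S (n + m)) - x (n + m)%nat) (x (n + m)%nat - x n)) as T.
    replace (x (S (n + m)) - x (n + m)%nat + (x (n + m)%nat - x n))
      with (x (S (n + m)) - x n) in T by ring. lra. }
assert (Hd : 0 <= d).
{ specialize (H O). simpl in H. pose proof (Rabs_pos (x 1%nat - x O)). lra. }
assert (B' : forall n m : nat, Rabs (x (n + m)%nat - x n) <= 2 * d * (/ 2) ^ n).
{ intros n m. eapply Rle_trans; [apply B|].
  assert (0 <= 2 * d * (/ 2) ^ (n + m))
    by (apply Rmult_le_pos; [lra|apply pow_le; lra]). lra. }
assert (Cau : ex_lim_seq_cauchy x).
{ intros eps.
  assert (L : is_lim_seq (fun n => 4 * d * (/ 2) ^ n) (4 * d * 0)).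
  { apply (is_lim_seq_scal_l (fun n => (/ 2) ^ n) (4 * d) 0), is_lim_seq_geom.
    rewrite Rabs_pos_eq; lra. }
  rewrite Rmult_0_r in L. apply is_lim_seq_spec in L. destruct (L eps) as [N HN].
  exists N. intros n m Hn Hm. specialize (HN N (le_n N)). apply Rabs_def2 in HN.
  pose proof (B' N (n - N)%nat) as Bn. pose proof (B' N (m - N)%nat) as Bm.
  replace (N + (n - N))%nat with n in Bn by lia. replace (N + (m - N))%nat with m in Bm by lia.
  replace (x n - x m) with ((x n - x N) - (x m - x N)) by ring.
  eapply Rle_lt_trans; [apply Rabs_triang|]. rewrite Rabs_Ropp. lra. }
apply ex_lim_seq_cauchy_corr in Cau. destruct Cau as [l Hl].
exists l. intros n.
assert (L1 : is_lim_seq (fun m => Rabs (x (m + n)%nat - x n)) (Rabs (l - x n))).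
{ apply (is_lim_seq_abs _ (l - x n)). apply is_lim_seq_minus'; [|apply is_lim_seq_const].
  apply (is_lim_seq_incr_n x n l), Hl. }
rewrite Rabs_minus_sym.
refine (is_lim_seq_le _ _ (Finite _) (Finite _) _ L1 (is_lim_seq_const _)).
intros m. rewrite Nat.add_comm. apply B'.
Qed.

Lemma geometric_limit_C (x : nat -> C) (d : R) :
  (forall n : nat, Cmod (x (S n) - x n) <= d * (/ 2) ^ n) ->
  exists l : C, forall n : nat, Cmod (x n - l) <= 4 * d * (/ 2) ^ n.
Proof.
intros H.
destruct (geometric_limit_R (fun n => Re (x n)) d) as [lr Hr].
{ intros n. exact (Rle_trans _ _ _ (re_le_Cmod (x (S n) - x n)) (H n)). }
destruct (geometric_limit_R (fun n => Im (x n)) d) as [li Hi].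
{ intros n. exact (Rle_trans _ _ _ (im_le_Cmod (x (S n) - x n)) (H n)). }
exists (lr, li). intros n. eapply Rle_trans; [apply Cmod_le_Re_Im|].
specialize (Hr n). specialize (Hi n).
change (Rabs (Re (x n) - lr) + Rabs (Im (x n) - li) <= 4 * d * (/ 2) ^ n). lra.
Qed.

(** The constant is the smaller singular value of the real linear map h -> a h + b conj(h); it is
    positive exactly when the determinant |a|^2 - |b|^2 is nonzero. *)
Lemma Cmod_linear_lower_bound (a b h : C) :
  Rabs (Cmod a - Cmod b) * Cmod h <= Cmod (a * h + b * Cconj h).
Proof.
pose proof (Cmod_triangle (a * h + b * Cconj h) (- (b * Cconj h))) as T1.
pose proof (Cmod_triangle (a * h + b * Cconj h) (- (a * h))) as T2.
replace (a * h + b * Cconj h + - (b * Cconj h))%C with (a * h)%C in T1 by ring.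
replace (a * h + b * Cconj h + - (a * h))%C with (b * Cconj h)%C in T2 by ring.
rewrite Cmod_opp, !Cmod_mult, Cmod_conj in T1, T2.
unfold Rabs. destruct (Rcase_abs _); lra.
Qed.

(** The solution is delivered as a [sig] so that it can enter the definition of the Newton map. *)
Lemma linear_surjective (a b k : C) :
  Cmod a ^ 2 - Cmod b ^ 2 <> 0 -> {h : C | (a * h + b * Cconj h)%C = k}.
Proof.
intros HJ. set (J := (a * Cconj a - b * Cconj b)%C).
assert (EJ : J = RtoC (Cmod a ^ 2 - Cmod b ^ 2))
  by (unfold J; rewrite RtoC_minus, !Cmod2_conj; reflexivity).
assert (J0 : J <> 0) by (rewrite EJ; intros E; apply HJ; exact (f_equal Re E)).
assert (CJ : Cconj J = J) by (unfold J; rewrite Cminus_conj, !Cmult_conj, !Cconj_conj; ring).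
(* Cramer's rule for the equation and its conjugate, with unknowns h and conj(h). *)
exists ((Cconj a * k - b * Cconj k) / J)%C.
rewrite Cdiv_conj, CJ, Cminus_conj, !Cmult_conj, !Cconj_conj by exact J0.
replace (a * ((Cconj a * k - b * Cconj k) / J) + b * ((a * Cconj k - Cconj b * k) / J))%C
  with (k * (J / J))%C by (unfold J; field; exact J0).
field. exact J0.
Qed.

(** Newton iteration with the derivative frozen at [z0]. The lower bound [c] yields injectivity;
    solvability inside every small radius [s] yields openness of the image and continuity of the
    inverse. *)
Lemma inverse_function (D : C -> Prop) (f : C -> C) (z0 : C) :
  open D -> Ck 1 D f -> D z0 -> jacobian f z0 <> 0 ->
  exists r c : R, 0 < r /\ 0 < c /\
    (forall x : C, Cmod (x - z0) < r -> D x) /\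
    (forall x y : C, Cmod (x - z0) < r -> Cmod (y - z0) < r ->
       c * Cmod (y - x) <= Cmod (f y - f x)) /\
    (forall s : R, 0 < s <= r -> exists t : R, 0 < t /\
       forall w : C, Cmod (w - f z0) < t -> exists x : C, Cmod (x - z0) < s /\ f x = w).
Proof.
intros HD Hf Hz0 HJ. set (a := dz f z0). set (b := dzbar f z0).
pose proof (Cmod_ge_0 a) as a0. pose proof (Cmod_ge_0 b) as b0.
set (c := Rabs (Cmod a - Cmod b)).
assert (c0 : 0 < c).
{ apply Rabs_pos_lt. intros E. apply HJ. unfold jacobian. fold a b.
  replace (Cmod a) with (Cmod b) by lra. ring. }
destruct (proj1 (locally_Cmod _ _) (HD z0 Hz0)) as (r1 & r10 & Hr1).
pose proof Hf as (_ & Hp & (Cx & _) & (Ce & _)).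
(* An error of half the lower bound leaves expansion by at least c / 2 and makes the Newton map
   contract by 1/2. *)
destruct (strict_differentiability D f z0 HD Hz0 Hp (Cx z0 Hz0) (Ce z0 Hz0) (c / 2))
  as (r2 & r20 & Hr2); [lra|]. fold a b in Hr2.
exists (Rmin r1 r2), (c / 2).
assert (R1 := Rmin_l r1 r2). assert (R2 := Rmin_r r1 r2).
assert (R0 : 0 < Rmin r1 r2) by (apply Rmin_glb_lt; assumption).
split; [exact R0|]. split; [lra|]. split; [intros x Hx; apply Hr1; lra|].
split.
{ intros x y Hx Hy.
  assert (Hxy := Hr2 x y ltac:(lra) ltac:(lra)).
  pose proof (Cmod_linear_lower_bound a b (y - x)) as Lb. fold c in Lb.
  pose proof (Cmod_triangle (f y - f x)
    (- (f y - f x - a * (y - x) - b * Cconj (y - x)))) as T.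
  rewrite Cmod_opp in T.
  match type of T with Cmod ?u <= _ =>
    replace u with (a * (y - x) + b * Cconj (y - x))%C in T by ring end. lra. }
(* The first Newton step then has length d < s / 8, the iterates stay within 2 d of [z0], and the
   limit lies within 4 d < s / 2. *)
intros s [s0 Hs]. exists (c * s / 8).
split; [apply Rdiv_lt_0_compat; [apply Rmult_lt_0_compat; assumption|lra]|].
intros w Hw.
pose proof (fun k => linear_surjective a b k HJ) as HL.
(* Newton map for f x = w with the derivative taken at [z0]. *)
set (T := fun x => (x - proj1_sig (HL (f x - w)))%C).
assert (HT : forall x, (a * (x - T x) + b * Cconj (x - T x))%C = (f x - w)%C).
{ intros x. unfold T. destruct (HL (f x - w)%C) as [h Hh]. simpl.
  replace (x - (x - h))%C with h by ring. exact Hh. }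
assert (HT2 : forall x y, Cmod (x - z0) < r2 -> Cmod (y - z0) < r2 ->
  Cmod (T y - T x) <= / 2 * Cmod (y - x)).
{ intros x y Hx Hy. pose proof (Hr2 x y Hx Hy) as Hxy.
  pose proof (Cmod_linear_lower_bound a b (T y - T x)) as Lb. fold c in Lb.
  replace (a * (T y - T x) + b * Cconj (T y - T x))%C
    with (- (f y - f x - a * (y - x) - b * Cconj (y - x)))%C in Lb.
  - rewrite Cmod_opp in Lb. apply Rmult_le_reg_l with c; lra.
  - pose proof (HT x) as Ex. pose proof (HT y) as Ey.
    replace (f y - f x)%C with ((f y - w) - (f x - w))%C by ring.
    rewrite <- Ex, <- Ey, !Cminus_conj. ring. }
set (x := fun n => Nat.iter n T z0).
set (d := Cmod (x 1%nat - x 0%nat)).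
assert (d0 : 0 <= d) by apply Cmod_ge_0.
assert (Hd : d < s / 8).
{ pose proof (Cmod_linear_lower_bound a b (z0 - T z0)) as Lb. fold c in Lb.
  rewrite HT in Lb. unfold d. simpl.
  replace (T z0 - z0)%C with (- (z0 - T z0))%C by ring. rewrite Cmod_opp.
  replace (f z0 - w)%C with (- (w - f z0))%C in Lb by ring. rewrite Cmod_opp in Lb.
  apply Rmult_lt_reg_l with c; lra. }
(* The two bounds need a joint induction: contraction is available only as long as the iterates
   remain in the disc. *)
assert (Hx : forall n, Cmod (x n - z0) <= 2 * d - 2 * d * (/ 2) ^ n /\
  Cmod (x (S n) - x n) <= d * (/ 2) ^ n).
{ induction n as [|n [IH1 IH2]].
  - split; [|simpl; fold (x 1%nat) (x 0%nat); unfold d; simpl; lra].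
    simpl. replace (z0 - z0)%C with (RtoC 0) by ring. rewrite Cmod_0. lra.
  - assert (K1 : Cmod (x (S n) - z0) <= 2 * d - 2 * d * (/ 2) ^ S n).
    { replace (x (S n) - z0)%C with ((x (S n) - x n) + (x n - z0))%C by ring.
      eapply Rle_trans; [apply Cmod_triangle|]. simpl pow. lra. }
    split; [exact K1|].
    assert (0 <= d * (/ 2) ^ n) by (apply Rmult_le_pos; [lra|apply pow_le; lra]).
    pose proof (HT2 (x n) (x (S n))) as K2.
    eapply Rle_trans; [apply K2; simpl pow in *; lra|]. simpl pow. lra. }
destruct (geometric_limit_C x d (fun n => proj2 (Hx n))) as [l Hl].
assert (Hlz : Cmod (l - z0) < s).
{ specialize (Hl O). simpl in Hl. replace (l - z0)%C with (- (z0 - l))%C by ring.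
  rewrite Cmod_opp. lra. }
exists l. split; [exact Hlz|].
assert (K : Cmod (f l - w) <= 0).
{ apply le_geometric_0 with (K := (c / 2 + Cmod a + Cmod b) * (4 * d) + (Cmod a + Cmod b) * d).
  intros n. specialize (Hl n). destruct (Hx n) as [Hn1 Hn2].
  assert (0 <= 2 * d * (/ 2) ^ n) by (apply Rmult_le_pos; [lra|apply pow_le; lra]).
  assert (K1 := Hr2 l (x n) ltac:(lra) ltac:(lra)).
  replace (f l - w)%C with
    ((f (x n) - w) + - (f (x n) - f l - a * (x n - l) - b * Cconj (x n - l))
     + - (a * (x n - l) + b * Cconj (x n - l)))%C by ring.
  rewrite <- HT.
  assert (BL : forall h, Cmod (a * h + b * Cconj h) <= (Cmod a + Cmod b) * Cmod h).
  { intros h. eapply Rle_trans; [apply Cmod_triangle|].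
    rewrite !Cmod_mult, Cmod_conj. lra. }
  eapply Rle_trans; [apply Cmod_triangle|].
  rewrite Cmod_opp. pose proof (BL (x n - l)%C) as B1.
  pose proof (BL (x n - T (x n))%C) as B2.
  replace (Cmod (x n - T (x n))) with (Cmod (x (S n) - x n)) in B2.
  2:{ rewrite <- Cmod_opp. f_equal. change (x (S n)) with (T (x n)). ring. }
  apply Rmult_le_compat_l with (r := Cmod a + Cmod b) in Hn2; [|lra].
  apply Rmult_le_compat_l with (r := c / 2 + (Cmod a + Cmod b)) in Hl; [|lra].
  match goal with |- Cmod (?u + ?v) + _ <= _ => pose proof (Cmod_triangle u v) as T1 end.
  rewrite Cmod_opp in T1. lra. }
pose proof (Cmod_ge_0 (f l - w)).
assert (E : (f l - w)%C = 0) by (apply Cmod_eq_0; lra).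
replace (f l) with ((f l - w) + w)%C by ring. rewrite E. ring.
Qed.

(** The derivatives are those of the inverse linear map. Continuity of [h] brings h w close enough
    to h w0 for the expansion of [u] to apply, and the lower bound on the linear map turns an error
    small against |h w - h w0| into one small against |w - w0|. *)
Lemma cdiff_inverse (u h : C -> C) (w0 a b : C) :
  Cmod a ^ 2 - Cmod b ^ 2 <> 0 -> cdiff u (h w0) a b -> continuous h w0 ->
  locally w0 (fun w => u (h w) = w) ->
  cdiff h w0 (Cconj a / RtoC (Cmod a ^ 2 - Cmod b ^ 2)) (- b / RtoC (Cmod a ^ 2 - Cmod b ^ 2)).
Proof.
intros HJ Hu Hc Hh eps He.
pose proof (Cmod_ge_0 a) as a0. pose proof (Cmod_ge_0 b) as b0.
set (J := RtoC (Cmod a ^ 2 - Cmod b ^ 2)).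
assert (J0 : J <> 0) by (intros E; apply HJ; exact (f_equal Re E)).
assert (EJ : J = (a * Cconj a - b * Cconj b)%C)
  by (unfold J; rewrite RtoC_minus, !Cmod2_conj; reflexivity).
pose proof (proj1 (Cmod_gt_0 J) J0) as Jm.
set (c := Rabs (Cmod a - Cmod b)).
assert (c0 : 0 < c).
{ apply Rabs_pos_lt. intros E. apply HJ. replace (Cmod a) with (Cmod b) by lra. ring. }
set (M := Cmod a + Cmod b + 1). assert (M0 : 0 < M) by (unfold M; lra).
set (eps' := eps * Cmod J * c / (2 * M)).
assert (He' : 0 < eps').
{ apply Rdiv_lt_0_compat; [|lra]. repeat apply Rmult_lt_0_compat; assumption. }
(* The bound c / 2 makes [h] Lipschitz at [w0]; [eps'] makes the resulting error at most [eps]. *)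
assert (He2 : 0 < Rmin (c / 2) eps') by (apply Rmin_glb_lt; lra).
pose proof (Hc _ (Hu _ He2)) as L. unfold filtermap in L.
pose proof (locally_singleton _ _ Hh) as E0.
apply filter_imp with (2 := filter_and _ _ L Hh). intros w [Hw Ew]. rewrite E0, Ew in Hw.
set (k := (h w - h w0)%C) in *.
set (e := (w - w0 - a * k - b * Cconj k)%C) in *.
assert (He1 : Cmod e <= c / 2 * Cmod k).
{ eapply Rle_trans; [exact Hw|]. apply Rmult_le_compat_r; [apply Cmod_ge_0|apply Rmin_l]. }
assert (He3 : Cmod e <= eps' * Cmod k).
{ eapply Rle_trans; [exact Hw|]. apply Rmult_le_compat_r; [apply Cmod_ge_0|apply Rmin_r]. }
assert (Hk : c / 2 * Cmod k <= Cmod (w - w0)).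
{ pose proof (Cmod_linear_lower_bound a b k) as Lb. fold c in Lb.
  pose proof (Cmod_triangle (w - w0) (- e)) as T. rewrite Cmod_opp in T.
  replace (w - w0 + - e)%C with (a * k + b * Cconj k)%C in T by (unfold e; ring). lra. }
(* The remainder of [h] is minus the inverse linear map applied to the remainder [e] of [u]. *)
match goal with |- Cmod ?v <= _ => replace v with (- (Cconj a * e - b * Cconj e) / J)%C end.
2:{ unfold e. rewrite !Cminus_conj, !Cmult_conj, !Cconj_conj.
  transitivity ((J * k - Cconj a * (w - w0) + b * (Cconj w - Cconj w0)) / J)%C;
    [|field; exact J0].
  unfold Cdiv. f_equal. rewrite EJ. ring. }
rewrite Cmod_div, Cmod_opp by exact J0.
pose proof (Cmod_triangle (Cconj a * e) (- (b * Cconj e))) as T.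
rewrite Cmod_opp, !Cmod_mult, !Cmod_conj in T.
change (Cconj a * e + - (b * Cconj e))%C with (Cconj a * e - b * Cconj e)%C in T.
apply Rmult_le_reg_r with (1 := Jm).
unfold Rdiv. rewrite Rmult_assoc, Rinv_l, Rmult_1_r by lra.
pose proof (Cmod_ge_0 e).
assert (K1 : M * Cmod e <= M * (eps' * Cmod k)) by (apply Rmult_le_compat_l; lra).
assert (K2 : M * (eps' * Cmod k) = eps * Cmod J * (c / 2 * Cmod k))
  by (unfold eps'; field; lra).
assert (K3 : eps * Cmod J * (c / 2 * Cmod k) <= eps * Cmod J * Cmod (w - w0)).
{ apply Rmult_le_compat_l; [|exact Hk]. apply Rmult_le_pos; lra. }
unfold M in K1 at 1. lra.
Qed.

Lemma smooth_cdiff (D : C -> Prop) (f : C -> C) (z : C) :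
  open D -> smooth D f -> D z -> cdiff f z (dz f z) (dzbar f z).
Proof. intros HD Hf. exact (Ck_cdiff 0 D f z HD (Hf 1%nat)). Qed.

Lemma smooth_dz (D : C -> Prop) (f : C -> C) : open D -> smooth D f -> smooth D (dz f).
Proof. intros HD Hf k. exact (Ck_dz k D f HD (Hf (S k))). Qed.

Lemma smooth_dzbar (D : C -> Prop) (f : C -> C) : open D -> smooth D f -> smooth D (dzbar f).
Proof. intros HD Hf k. exact (Ck_dzbar k D f HD (Hf (S k))). Qed.

(** Bootstrap: the derivatives of [h] are smooth functions on [D] composed with [h], so each order
    of smoothness of [h] yields the next, starting from continuity. *)
Lemma smooth_inverse (D W : C -> Prop) (f h : C -> C) :
  open D -> open W -> smooth D f -> (forall z, D z -> jacobian f z <> 0) ->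
  (forall w, W w -> D (h w)) -> (forall w, W w -> f (h w) = w) ->
  (forall w, W w -> continuous h w) -> smooth W h.
Proof.
intros HD HW Hf HJ Hm Hr Hc k.
set (J := fun z => (dz f z * Cconj (dz f z) - dzbar f z * Cconj (dzbar f z))%C).
assert (EJ : forall z, RtoC (jacobian f z) = J z)
  by (intros z; unfold jacobian; rewrite RtoC_minus, !Cmod2_conj; reflexivity).
assert (SJ : forall k, Ck k D (fun z => / J z)%C).
{ intros j. apply Ck_inv; [exact HD| |].
  - intros z Hz E. apply (HJ z Hz). rewrite <- EJ in E. exact (f_equal Re E).
  - apply Ck_minus; [exact HD| |]; (apply Ck_mult; [exact HD| |]);
      try (apply Ck_conj; [exact HD|]);
      try (apply smooth_dz; assumption); apply smooth_dzbar; assumption. }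
induction k as [|k IH].
- split; [exact Hc|exact I].
- apply Ck_S_intro with (a := fun w => (Cconj (dz f (h w)) * / J (h w))%C)
    (b := fun w => (- (1) * dzbar f (h w) * / J (h w))%C); [exact HW| | |].
  + intros w Hw. eapply cdiff_eq.
    * apply (cdiff_inverse f h w _ _ (HJ _ (Hm w Hw))).
      -- exact (smooth_cdiff D f _ HD Hf (Hm w Hw)).
      -- exact (Hc w Hw).
      -- apply filter_imp with (2 := HW w Hw). exact Hr.
    * fold (jacobian f (h w)). rewrite EJ. reflexivity.
    * fold (jacobian f (h w)). rewrite EJ. unfold Cdiv. ring.
  + apply (Ck_comp k W D (fun z => Cconj (dz f z) * / J z)%C h HW HD Hm); [|exact IH].
    apply Ck_mult; [exact HD| |apply SJ]. apply Ck_conj, smooth_dz; assumption.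
  + apply (Ck_comp k W D (fun z => - (1) * dzbar f z * / J z)%C h HW HD Hm); [|exact IH].
    apply Ck_mult; [exact HD| |apply SJ]. apply Ck_scal, smooth_dzbar; assumption.
Qed.

Lemma continuous_section (V : C -> Prop) (u : C -> C) :
  open V -> Ck 1 V u -> injective_on V u -> (forall z, V z -> jacobian u z <> 0) ->
  open (image V u) /\
  exists h : C -> C, (forall z, V z -> h (u z) = z) /\ forall z, V z -> continuous h (u z).
Proof.
intros HV Hu Hi HJ.
assert (K : forall z, V z -> forall s, 0 < s ->
  locally (u z) (fun w => exists x, V x /\ Cmod (x - z) < s /\ w = u x)).
{ intros z Hz s s0.
  destruct (inverse_function V u z HV Hu Hz (HJ z Hz)) as (r & c & r0 & _ & Hr & _ & Hs).
  destruct (Hs (Rmin r s)) as (t & t0 & Ht).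
  { split; [apply Rmin_glb_lt; assumption|apply Rmin_l]. }
  apply locally_Cmod. exists t. split; [exact t0|]. intros w Hw.
  destruct (Ht w Hw) as (x & Hx & E). exists x.
  assert (R1 := Rmin_l r s). assert (R2 := Rmin_r r s).
  split; [apply Hr; lra|]. split; [lra|auto]. }
split.
- intros w [z [Hz ->]]. apply filter_imp with (2 := K z Hz 1 Rlt_0_1).
  intros w (x & Hx & _ & E). exists x. auto.
(* A preimage is chosen by [epsilon]; injectivity makes it the right one on the image, and the value
   elsewhere is arbitrary. *)
- set (h := fun w => epsilon (inhabits (RtoC 0)) (fun z => V z /\ w = u z)).
  assert (Hh : forall z, V z -> h (u z) = z).
  { intros z Hz.
    assert (S : V (h (u z)) /\ u z = u (h (u z)))
      by (apply (epsilon_spec (inhabits (RtoC 0)) (fun x => V x /\ u z = u x)); exists z; auto).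
    destruct S as [S1 S2]. symmetry. apply Hi; assumption. }
  exists h. split; [exact Hh|]. intros z Hz. apply continuous_Cmod. intros eps He.
  apply filter_imp with (2 := K z Hz eps He). intros w (x & Hx & Hxz & ->).
  rewrite !Hh by assumption. exact Hxz.
Qed.

(** * Beltrami equation and harmonic maps *)

Lemma beltrami_dz_neq_0 (omega : C -> R) (D : C -> Prop) (u : C -> C) (z : C) :
  beltrami omega D u -> D z -> dz u z <> RtoC 0.
Proof. intros H Hz. exact (proj1 (H z Hz)). Qed.

Lemma beltrami_dzbar (omega : C -> R) (D : C -> Prop) (u : C -> C) (z : C) :
  beltrami omega D u -> D z -> dzbar u z = (RtoC (exp (- 2 * omega z)) * dz u z)%C.
Proof. intros H Hz. destruct (H z Hz) as [H0 E]. rewrite <- E. field. exact H0. Qed.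

Lemma jacobian_beltrami (omega : C -> R) (D : C -> Prop) (u : C -> C) (z : C) :
  beltrami omega D u -> D z ->
  jacobian u z = Cmod (dz u z) ^ 2 * (1 - exp (- 2 * omega z) ^ 2).
Proof.
intros H Hz. unfold jacobian. rewrite (beltrami_dzbar _ _ _ _ H Hz), Cmod_mult, Cmod_R.
rewrite Rpow_mult_distr, pow2_abs. ring.
Qed.

(** The right side mentions only [omega], so nondegeneracy transfers between any two solutions of
    the same Beltrami equation. *)
Lemma jacobian_neq_0_iff (omega : C -> R) (D : C -> Prop) (u : C -> C) (z : C) :
  beltrami omega D u -> D z ->
  (jacobian u z <> 0 <-> 1 - exp (- 2 * omega z) ^ 2 <> 0).
Proof.
intros H Hz. rewrite (jacobian_beltrami _ _ _ _ H Hz).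
pose proof (proj1 (Cmod_gt_0 _) (beltrami_dz_neq_0 _ _ _ _ H Hz)) as P.
split; intros K E; apply K.
- rewrite E. ring.
- apply Rmult_integral in E. destruct E as [E|E]; [|exact E].
  apply pow_lt with (n := 2%nat) in P. lra.
Qed.

(* At [u z] the function U o u^-1 has derivative U_z / u_z: its zbar-derivative
   (u_z U_zbar - u_zbar U_z) / jacobian vanishes because both maps have the same
   Beltrami coefficient. *)
Lemma holomorphic_factor (omega : C -> R) (V : C -> Prop) (u U : C -> C) :
  open V -> Ck 1 V u -> Ck 1 V U -> injective_on V u ->
  (forall z, V z -> jacobian u z <> 0) -> beltrami omega V u -> beltrami omega V U ->
  holomorphic_function_of V u U.
Proof.
intros HV Hu HU Hi HJ Bu BU.
destruct (continuous_section V u HV Hu Hi HJ) as (Ho & h & Hh & Hc).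
exists (fun w => U (h w)). split.
2:{ intros z Hz. rewrite Hh by exact Hz. reflexivity. }
split; [exact Ho|]. intros w [z [Hz ->]].
exists (dz U z / dz u z)%C. apply is_derive_C_iff.
pose proof (Ck_cdiff 0 V u z HV Hu Hz) as Du. pose proof (Ck_cdiff 0 V U z HV HU Hz) as DU.
(* The chain rule for U o h at [u z] differentiates [u] and [U] at [h (u z)]. *)
rewrite <- (Hh z Hz) in Du at 1. rewrite <- (Hh z Hz) in DU at 1.
assert (L : locally (u z) (fun w => u (h w) = w)).
{ apply filter_imp with (2 := Ho (u z) (ex_intro _ z (conj Hz eq_refl))).
  intros w [x [Hx ->]]. rewrite Hh by exact Hx. reflexivity. }
pose proof (cdiff_comp _ _ _ _ _ _ _ DU (cdiff_inverse u h (u z) _ _ (HJ z Hz) Du (Hc z Hz) L))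
  as K.
pose proof (beltrami_dz_neq_0 _ _ _ _ Bu Hz) as a0.
pose proof (HJ z Hz) as J0. rewrite (jacobian_beltrami _ _ _ _ Bu Hz) in J0.
rewrite (jacobian_beltrami _ _ _ _ Bu Hz : Cmod (dz u z) ^ 2 - Cmod (dzbar u z) ^ 2 = _) in K.
rewrite (beltrami_dzbar _ _ _ _ Bu Hz), (beltrami_dzbar _ _ _ _ BU Hz) in K.
set (m := exp (- 2 * omega z)) in *. set (a := dz u z) in *.
set (j := RtoC (Cmod a ^ 2 * (1 - m ^ 2))) in *.
assert (Cj : Cconj j = j) by (apply injective_projections; simpl; ring).
assert (Cm : Cconj (RtoC m) = RtoC m) by (apply injective_projections; simpl; ring).
assert (Ej : j = (a * Cconj a * (1 - RtoC m * RtoC m))%C).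
{ unfold j. rewrite RtoC_mult, Cmod2_conj, RtoC_minus. simpl pow.
  rewrite !RtoC_mult. ring. }
assert (j0 : j <> 0) by (intros E; apply J0; exact (f_equal Re E)).
refine (cdiff_eq _ _ _ _ _ _ K _ _).
- rewrite Cdiv_conj, Copp_conj, Cmult_conj, Cj, Cm by exact j0.
  transitivity (dz U z * (Cconj a * (1 - RtoC m * RtoC m)) / j)%C; [field; exact j0|].
  transitivity (dz U z * (a * Cconj a * (1 - RtoC m * RtoC m)) / (a * j))%C;
    [field; auto|]. rewrite <- Ej. field. auto.
- rewrite Cdiv_conj, Cconj_conj, Cj by exact j0. field. exact j0.
Qed.

(** * Harmonic map equation and curvature of the target *)

Lemma dz_ext_loc (f g : C -> C) (z : C) :
  locally z (fun y => f y = g y) -> dz f z = dz g z.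
Proof.
intros H. destruct (partials_ext_loc f g z H) as (E1 & E2 & _).
unfold dz. rewrite E1, E2. reflexivity.
Qed.

Lemma dzbar_ext_loc (f g : C -> C) (z : C) :
  locally z (fun y => f y = g y) -> dzbar f z = dzbar g z.
Proof.
intros H. destruct (partials_ext_loc f g z H) as (E1 & E2 & _).
unfold dzbar. rewrite E1, E2. reflexivity.
Qed.

Lemma dzbar_real (g : C -> R) (z : C) :
  dzbar (fun p => RtoC (g p)) z = Cconj (dz (fun p => RtoC (g p)) z).
Proof.
unfold dzbar, dz, d_xi, d_eta. simpl. rewrite !Derive_const.
apply injective_projections; simpl; field.
Qed.

Lemma Cconj_RtoC (x : R) : Cconj (RtoC x) = RtoC x.
Proof. apply injective_projections; simpl; ring. Qed.

Lemma cdiff_exp_comp (g : C -> R) (z a b : C) :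
  cdiff (fun p => RtoC (g p)) z a b ->
  cdiff (fun p => RtoC (exp (g p))) z (RtoC (exp (g z)) * a) (RtoC (exp (g z)) * b).
Proof.
intros H.
(* For a real function the derivatives are conjugate, so the two halves produced by the real part
   add up to the full derivative. *)
assert (E : b = Cconj a)
  by (rewrite <- (cdiff_dz _ _ _ _ H), <- (cdiff_dzbar _ _ _ _ H); apply dzbar_real).
eapply cdiff_eq.
- exact (cdiff_comp (fun w => RtoC (exp (Re w))) (fun p => RtoC (g p)) z _ _ _ _
    (cdiff_real_fun exp _ (RtoC (g z)) (is_derive_exp _)) H).
- rewrite E, Cconj_conj, RtoC_div by lra. simpl. field.
- rewrite E, RtoC_div by lra. simpl. field.
Qed.

Lemma cdiff_ln_comp (g : C -> R) (z a b : C) :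
  0 < g z -> cdiff (fun p => RtoC (g p)) z a b ->
  cdiff (fun p => RtoC (ln (g p))) z (a / RtoC (g z)) (b / RtoC (g z)).
Proof.
intros Hg H.
assert (E : b = Cconj a)
  by (rewrite <- (cdiff_dz _ _ _ _ H), <- (cdiff_dzbar _ _ _ _ H); apply dzbar_real).
assert (Hg0 : RtoC (g z) <> 0) by (intros K; apply (f_equal Re) in K; simpl in K; lra).
eapply cdiff_eq.
- exact (cdiff_comp (fun w => RtoC (ln (Re w))) (fun p => RtoC (g p)) z _ _ _ _
    (cdiff_real_fun ln _ (RtoC (g z)) (is_derive_ln _ Hg)) H).
- rewrite E, Cconj_conj, RtoC_div, RtoC_inv by lra. simpl. field. exact Hg0.
- rewrite E, RtoC_div, RtoC_inv by lra. simpl. field. exact Hg0.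
Qed.

(* Commuting d/dz with d/dzbar in U_zbar = m U_z, where m = exp(-2 omega). *)
Lemma beltrami_dzbar_dz (omega : C -> R) (D : C -> Prop) (U : C -> C) (z : C) :
  open D -> smooth_real D omega -> smooth D U -> beltrami omega D U -> D z ->
  dzbar (dz U) z = (RtoC (exp (- 2 * omega z)) *
    (dz (dz U) z - 2 * dz (fun p => RtoC (omega p)) z * dz U z))%C.
Proof.
intros HD Hw HU BU Hz. rewrite <- (dz_dzbar D U z HD (HU 2%nat) Hz).
rewrite (dz_ext_loc _ (fun y => RtoC (exp (- 2 * omega y)) * dz U y)%C).
2:{ apply filter_imp with (2 := HD z Hz). intros y Hy.
  exact (beltrami_dzbar _ _ _ _ BU Hy). }
pose proof (smooth_cdiff D _ z HD Hw Hz) as Dw.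
pose proof (smooth_cdiff D _ z HD (smooth_dz D U HD HU) Hz) as Da.
assert (D2 := cdiff_scal _ (RtoC (-2)) _ _ _ Dw).
assert (D2' : cdiff (fun p => RtoC (- 2 * omega p)) z
   (RtoC (-2) * dz (fun p => RtoC (omega p)) z)
   (RtoC (-2) * dzbar (fun p => RtoC (omega p)) z)).
{ refine (cdiff_ext_loc _ _ _ _ _ _ D2). apply filter_forall. intros y.
  symmetry. apply RtoC_mult. }
rewrite (cdiff_dz _ _ _ _ (cdiff_mult _ _ _ _ _ _ _ (cdiff_exp_comp _ _ _ _ D2') Da)).
ring.
Qed.

Lemma Cminus_0_eq (x y : C) : (x - y)%C = 0 -> x = y.
Proof. intros H. replace x with ((x - y) + y)%C by ring. rewrite H. ring. Qed.

(** Both terms of the harmonic map equation carry the positive factor m = exp(-2 omega): U_zbar = m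
    U_z, and U_{z zbar} = m (U_zz - 2 omega_z U_z). *)
Lemma harmonic_factor (omega F : C -> R) (D : C -> Prop) (U : C -> C) (z : C) :
  open D -> smooth_real D omega -> smooth D U -> beltrami omega D U -> D z ->
  ((dzbar (dz U) z + dz (fun w => RtoC (F w)) (U z) * dz U z * dzbar U z)%C = RtoC 0 <->
   (dz (fun w => RtoC (F w)) (U z) * dz U z * dz U z)%C =
   (2 * dz (fun p => RtoC (omega p)) z * dz U z - dz (dz U) z)%C).
Proof.
intros HD Hw HU BU Hz.
rewrite (beltrami_dzbar_dz omega D U z HD Hw HU BU Hz), (beltrami_dzbar _ _ _ _ BU Hz).
set (m := RtoC (exp (- 2 * omega z))). set (P := dz (fun w => RtoC (F w)) (U z)).
set (w1 := dz (fun p => RtoC (omega p)) z). set (a := dz U z). set (b := dz (dz U) z).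
assert (m0 : m <> 0).
{ intros E. apply (f_equal Re) in E. simpl in E.
  pose proof (exp_pos (- 2 * omega z)). lra. }
split; intros H.
- apply Cminus_0_eq. transitivity ((m * (b - 2 * w1 * a) + P * a * (m * a)) / m)%C.
  + field. exact m0.
  + rewrite H. field. exact m0.
- transitivity (m * (P * a * a - (2 * w1 * a - b)))%C; [ring|]. rewrite H. ring.
Qed.

(* With a = U_z, m = exp(-2 omega) and p = F_w o U, the harmonic map equation reads
   p a^2 = 2 omega_z a - a_z.  Applying d/dzbar - m d/dz to it, the terms in a_z and
   a_zz cancel and (1 - m^2) |a|^2 F_{w wbar}(U) = 2 omega_{z zbar} is left. *)
Lemma laplacian_F (omega F : C -> R) (Omega W : C -> Prop) (U : C -> C) (z : C) :
  open Omega -> open W -> smooth_real W F -> smooth Omega U ->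
  (forall z, Omega z -> W (U z)) -> smooth_real Omega omega ->
  harmonic F Omega U -> beltrami omega Omega U -> Omega z ->
  (dzbar (dz (fun w => RtoC (F w))) (U z) * (dz U z * Cconj (dz U z)) *
     (1 - RtoC (exp (- 2 * omega z)) * RtoC (exp (- 2 * omega z))))%C =
  (2 * dzbar (dz (fun p => RtoC (omega p))) z)%C.
Proof.
intros HO HW HF HU Hm Hw Hh BU Hz.
set (P := dz (fun w => RtoC (F w))). set (w1 := dz (fun p => RtoC (omega p))).
set (a := dz U). set (b := dz a). set (m := RtoC (exp (- 2 * omega z))).
assert (Sa : smooth Omega a) by (apply smooth_dz; assumption).
assert (Sb : smooth Omega b) by (apply smooth_dz; assumption).
assert (Sw : smooth Omega w1) by (apply smooth_dz; assumption).
pose proof (beltrami_dz_neq_0 _ _ _ _ BU Hz) as a0. fold a in a0.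
pose proof (smooth_cdiff _ _ _ HO HU Hz) as DU. fold a in DU.
rewrite (beltrami_dzbar _ _ _ _ BU Hz) in DU. fold m a in DU.
pose proof (smooth_cdiff _ _ _ HO Sa Hz) as Da.
pose proof (smooth_cdiff _ _ _ HO Sb Hz) as Db.
pose proof (smooth_cdiff _ _ _ HO Sw Hz) as Dw.
pose proof (smooth_cdiff W P (U z) HW (smooth_dz _ _ HW HF) (Hm z Hz)) as DP.
assert (Ea : forall y, Omega y -> dzbar a y
  = (RtoC (exp (- 2 * omega y)) * (b y - 2 * w1 y * a y))%C)
  by (intros y Hy; exact (beltrami_dzbar_dz omega Omega U y HO Hw HU BU Hy)).
(* Commuting the derivatives once more: the zbar-derivative of U_zz is the z-derivative of [Ea]. *)
assert (Eb : dzbar b z = (RtoC (-2) * w1 z * m * (b z - 2 * w1 z * a z)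
  + m * (dz b z - 2 * (dz w1 z * a z + w1 z * b z)))%C).
{ unfold b at 1. rewrite <- (dz_dzbar Omega a z HO (Sa 2%nat) Hz).
  rewrite (dz_ext_loc _ (fun y => RtoC (exp (- 2 * omega y)) * (b y - 2 * (w1 y * a y)))%C).
  2:{ apply filter_imp with (2 := HO z Hz). intros y Hy. rewrite (Ea y Hy). ring. }
  assert (D2 : cdiff (fun p => RtoC (- 2 * omega p)) z (RtoC (-2) * w1 z)
     (RtoC (-2) * dzbar (fun p => RtoC (omega p)) z)).
  { refine (cdiff_ext_loc _ _ _ _ _ _
      (cdiff_scal _ (RtoC (-2)) _ _ _ (smooth_cdiff _ _ _ HO Hw Hz))).
    apply filter_forall. intros y. symmetry. apply RtoC_mult. }
  rewrite (cdiff_dz _ _ _ _ (cdiff_mult _ _ _ _ _ _ _ (cdiff_exp_comp _ _ _ _ D2)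
    (cdiff_minus _ _ _ _ _ _ _ Db (cdiff_scal _ (RtoC 2) _ _ _
      (cdiff_mult _ _ _ _ _ _ _ Dw Da))))).
  fold b m. ring. }
pose proof (cdiff_comp P U z _ _ _ _ DP DU) as Dp.
pose proof (cdiff_mult _ _ _ _ _ _ _ (cdiff_mult _ _ _ _ _ _ _ Dp Da) Da) as DL.
pose proof (cdiff_minus _ _ _ _ _ _ _ (cdiff_scal _ (RtoC 2) _ _ _
  (cdiff_mult _ _ _ _ _ _ _ Dw Da)) Db) as DR.
assert (L : locally z (fun y => (P (U y) * a y * a y)%C = (2 * (w1 y * a y) - b y)%C)).
{ apply filter_imp with (2 := HO z Hz). intros y Hy.
  pose proof (proj1 (harmonic_factor omega F Omega U y HO Hw HU BU Hy) (Hh y Hy)) as E.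
  fold P a b w1 in E. rewrite E. ring. }
pose proof (locally_singleton _ _ L) as Ep.
pose proof (dz_ext_loc (fun y : C => (P (U y) * a y * a y)%C)
  (fun y : C => (2 * (w1 y * a y) - b y)%C) z L) as X1.
pose proof (dzbar_ext_loc (fun y : C => (P (U y) * a y * a y)%C)
  (fun y : C => (2 * (w1 y * a y) - b y)%C) z L) as X2.
rewrite (cdiff_dz _ _ _ _ DL), (cdiff_dz _ _ _ _ DR) in X1.
rewrite (cdiff_dzbar _ _ _ _ DL), (cdiff_dzbar _ _ _ _ DR) in X2.
fold b in X1, X2. rewrite (Ea z Hz), Eb in X2.
unfold m in X1, X2. rewrite Cmult_conj, Cconj_RtoC in X1. fold m in X1, X2.
(* Since a_zbar - m a_z = -2 m omega_z a, differentiating a^2 leaves the residue -4 m omega_z p a^2;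
   adding 4 m omega_z times the equation itself removes it. *)
apply (f_equal (Cmult m)) in X1. apply (f_equal (Cmult (4 * w1 z * m)%C)) in Ep.
cbv beta in X1, X2, Ep.
set (Pz := dz P (U z)) in *. set (Pzb := dzbar P (U z)) in *.
set (p := P (U z)) in *. set (az := a z) in *. set (bz := b z) in *. set (w := w1 z) in *.
set (dbz := dz b z) in *. set (wz := dz w1 z) in *. set (wzb := dzbar w1 z) in *.
set (az' := Cconj az) in *.
assert (G : (az * (Pzb * (az * az') * (1 - m * m) - 2 * wzb))%C = 0).
{ match type of X1 with ?l1 = ?r1 => match type of X2 with ?l2 = ?r2 =>
    match type of Ep with ?l3 = ?r3 =>
    transitivity ((l2 - r2) - (l1 - r1) + (l3 - r3))%C end end end.
  - ring.
  - rewrite X1, X2, Ep. ring. }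
apply Cminus_0_eq.
transitivity ((az * (Pzb * (az * az') * (1 - m * m) - 2 * wzb)) / az)%C.
- field. exact a0.
- rewrite G. field. exact a0.
Qed.

Lemma sinh_factor (x : R) :
  RtoC (sinh (2 * x)) = ((1 - RtoC (exp (- 2 * x)) * RtoC (exp (- 2 * x)))
    / (2 * RtoC (exp (- 2 * x))))%C.
Proof.
pose proof (exp_pos (- 2 * x)) as P.
rewrite <- !RtoC_mult, <- RtoC_minus, <- RtoC_div by lra. f_equal.
unfold sinh. replace (- (2 * x)) with (- 2 * x) by ring.
replace (exp (2 * x)) with (/ exp (- 2 * x))
  by (rewrite <- exp_Ropp; f_equal; ring). field. lra.
Qed.

(** The Hopf normalization gives e^-F = m |U_z|^2 along the map, and sinh(2 omega) = (1 - m^2) / (2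
    m). Their product restores the left side of [laplacian_F]. The identity serves both ways, from
    sinh-Gordon to curvature and back. *)
Lemma gauss_curvature_sinh (omega F : C -> R) (Omega W : C -> Prop) (U : C -> C) (z : C) :
  open Omega -> open W -> smooth_real W F -> smooth Omega U ->
  (forall z, Omega z -> W (U z)) -> smooth_real Omega omega ->
  harmonic F Omega U -> beltrami omega Omega U ->
  (RtoC (exp (F (U z))) * dz U z * Cconj (dzbar U z))%C = RtoC 1 -> Omega z ->
  (gauss_curvature F (U z) * RtoC (sinh (2 * omega z)))%C =
  (- (2) * dzbar (dz (fun p => RtoC (omega p))) z)%C.
Proof.
intros HO HW HF HU Hm Hw Hh BU H1 Hz.
pose proof (laplacian_F omega F Omega W U z HO HW HF HU Hm Hw Hh BU Hz) as E.
rewrite (beltrami_dzbar _ _ _ _ BU Hz), Cmult_conj, Cconj_RtoC in H1.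
unfold gauss_curvature. rewrite sinh_factor, exp_Ropp, RtoC_inv
  by (pose proof (exp_pos (F (U z))); lra).
pose proof (exp_pos (- 2 * omega z)) as mp. pose proof (exp_pos (F (U z))) as Fp.
set (m := RtoC (exp (- 2 * omega z))) in *. set (q := RtoC (exp (F (U z)))) in *.
assert (m0 : m <> 0) by (intros K; apply (f_equal Re) in K; simpl in K; lra).
assert (q0 : q <> 0) by (intros K; apply (f_equal Re) in K; simpl in K; lra).
set (X := dzbar (dz (fun w => RtoC (F w))) (U z)) in *.
set (a := dz U z) in *.
transitivity (- (1) * (X * (a * Cconj a) * (1 - m * m)))%C.
2:{ rewrite E. ring. }
replace (/ q)%C with (a * (m * Cconj a))%C.
- field. exact m0.
- transitivity (q * a * (m * Cconj a) / q)%C; [field; exact q0|].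
  rewrite H1. field. exact q0.
Qed.

(** * Hopf differential in the special coordinate *)

Lemma cexp_half_sqr (l : C) : cexp (- l) = (cexp (- l / 2) * cexp (- l / 2))%C.
Proof.
destruct l as [x y].
replace (- (x, y) / 2)%C with ((- x / 2)%R, (- y / 2)%R)
  by (apply injective_projections; simpl; field).
replace (- (x, y))%C with ((- x / 2 + - x / 2)%R, (- y / 2 + - y / 2)%R)
  by (apply injective_projections; simpl; field).
unfold cexp. simpl. rewrite exp_plus, cos_plus, sin_plus.
apply injective_projections; simpl; ring.
Qed.

Lemma cexp_neq_0 (l : C) : cexp l <> 0.
Proof.
intros E. pose proof (f_equal Re E) as E1. pose proof (f_equal Im E) as E2. simpl in E1, E2.
pose proof (exp_pos (Re l)) as P. pose proof (sin2_cos2 (Im l)) as S. unfold Rsqr in S.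
apply Rmult_integral in E1. apply Rmult_integral in E2.
destruct E1 as [E1|E1]; [lra|]. destruct E2 as [E2|E2]; [lra|].
rewrite E1, E2 in S. lra.
Qed.

(** The Hopf differential is quadratic, so passing to zeta divides its coefficient exp(-lambda) by
    the square of Z' = exp(-lambda / 2). *)
Lemma hopf_coordinate_eq_1 (F : C -> R) (Omega : C -> Prop) (U : C -> C) :
  open Omega -> smooth Omega U -> hopf_coordinate F Omega U ->
  forall zeta, Omega zeta ->
    (RtoC (exp (F (U zeta))) * dz U zeta * Cconj (dzbar U zeta))%C = RtoC 1.
Proof.
intros HO HU (D & lambda & Z & Hl & HZ & _ & Him & Hh) zeta Hzeta.
destruct (proj1 (Him zeta) Hzeta) as (z & Hz & ->).
pose proof (proj1 (is_derive_C_iff _ _ _) (HZ z Hz)) as DZ.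
pose proof (smooth_cdiff _ _ _ HO HU Hzeta) as DU.
pose proof (cdiff_comp _ _ _ _ _ _ _ DU DZ) as DV.
specialize (Hh z Hz). unfold hopf in Hh.
rewrite (cdiff_dz _ _ _ _ DV), (cdiff_dz _ _ _ _ (cdiff_conj _ _ _ _ DV)) in Hh.
rewrite cexp_half_sqr in Hh. pose proof (cexp_neq_0 (- lambda z / 2)%C) as e0.
set (e := cexp (- lambda z / 2)%C) in *.
replace (Cconj (RtoC 0)) with (RtoC 0) in Hh by (apply injective_projections; simpl; ring).
replace (dz U (Z z) * 0 + dzbar U (Z z) * Cconj e)%C
  with (dzbar U (Z z) * Cconj e)%C in Hh by ring.
rewrite Cmult_conj, Cconj_conj in Hh.
match goal with |- ?l = _ => transitivity (l * (e * e) / (e * e))%C end.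
- field. exact e0.
- transitivity ((e * e) / (e * e))%C; [|field; exact e0]. f_equal.
  etransitivity; [|exact Hh]. ring.
Qed.

(** * Nondegeneracy, factorization and constant curvature *)

Lemma jacobian_left_inverse (f g : C -> C) (z a b A B : C) :
  cdiff f z a b -> cdiff g (f z) A B -> locally z (fun y => g (f y) = y) ->
  jacobian f z <> 0.
Proof.
intros Hf Hg L E. pose proof (cdiff_comp _ _ _ _ _ _ _ Hg Hf) as K.
apply cdiff_ext_loc with (g := fun y => y) in K; [|exact L].
pose proof (cdiff_dz _ _ _ _ K) as E1. pose proof (cdiff_dzbar _ _ _ _ K) as E2.
rewrite (cdiff_dz _ _ _ _ (cdiff_id z)) in E1.
rewrite (cdiff_dzbar _ _ _ _ (cdiff_id z)) in E2.
unfold jacobian in E. rewrite (cdiff_dz _ _ _ _ Hf), (cdiff_dzbar _ _ _ _ Hf) in E.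
assert (EC : (a * Cconj a - b * Cconj b)%C = 0)
  by (rewrite <- !Cmod2_conj, <- RtoC_minus, E; reflexivity).
(* The chain rule gives A a + B conj(b) = 1 and A b + B conj(a) = 0; eliminating B leaves conj(a) =
   A (|a|^2 - |b|^2). *)
assert (Ea : Cconj a = 0).
{ transitivity ((A * a + B * Cconj b) * Cconj a - (A * b + B * Cconj a) * Cconj b)%C.
  - rewrite <- E1, <- E2. ring.
  - transitivity (A * (a * Cconj a - b * Cconj b))%C; [ring|]. rewrite EC. ring. }
assert (a0 : a = 0) by (rewrite <- (Cconj_conj a), Ea; apply Cconj_RtoC).
assert (b0 : b = 0).
{ apply Cmod_eq_0. rewrite a0, Cmod_0 in E.
  assert (Cmod b ^ 2 = 0) by (simpl in *; lra).
  apply Rsqr_0_uniq. unfold Rsqr. simpl in *. lra. }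
rewrite a0, b0, Cconj_RtoC in E1. apply C1_nz. rewrite E1. ring.
Qed.

Lemma diffeomorphism_jacobian (D W : C -> Prop) (f : C -> C) :
  diffeomorphism D W f -> forall z, D z -> jacobian f z <> 0.
Proof.
intros (HD & HW & Hf & Him & g & Hg & Hgf) z Hz.
assert (HWz : W (f z)) by (apply Him; exists z; auto).
apply (jacobian_left_inverse f g z _ _ _ _ (smooth_cdiff _ _ _ HD Hf Hz)
  (smooth_cdiff _ _ _ HW Hg HWz)).
apply filter_imp with (2 := HD z Hz). exact Hgf.
Qed.

Lemma Ck_subset (k : nat) (D V : C -> Prop) (f : C -> C) :
  (forall z, V z -> D z) -> Ck k D f -> Ck k V f.
Proof.
intros HV. revert f. induction k as [|k IH]; intros f [Hc Hk]; (split; [auto|]).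
- exact I.
- destruct Hk as (Hp & Hx & He). auto.
Qed.

Lemma open_Cmod_ball (z0 : C) (r : R) : open (fun z : C => Cmod (z - z0) < r).
Proof.
intros z Hz. apply locally_Cmod. exists (r - Cmod (z - z0)). split; [lra|].
intros y Hy. replace (y - z0)%C with ((y - z) + (z - z0))%C by ring.
eapply Rle_lt_trans; [apply Cmod_triangle|lra].
Qed.

Lemma local_holomorphic_factor (omega : C -> R) (D : C -> Prop) (u U : C -> C) (z0 : C) :
  open D -> smooth D u -> smooth D U -> (forall z, D z -> jacobian u z <> 0) ->
  beltrami omega D u -> beltrami omega D U -> D z0 ->
  exists V : C -> Prop, open V /\ V z0 /\ (forall z, V z -> D z) /\
    holomorphic_function_of V u U.
Proof.
intros HD Hu HU HJ Bu BU Hz0.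
destruct (inverse_function D u z0 HD (Hu 1%nat) Hz0 (HJ z0 Hz0))
  as (r & c & r0 & c0 & Hr & Hc & _).
assert (HV : forall z, Cmod (z - z0) < r -> D z) by exact Hr.
exists (fun z => Cmod (z - z0) < r).
split; [apply open_Cmod_ball|]. split.
{ replace (z0 - z0)%C with (RtoC 0) by ring. rewrite Cmod_0. exact r0. }
split; [exact HV|].
apply (holomorphic_factor omega).
- apply open_Cmod_ball.
- exact (Ck_subset 1 D _ u HV (Hu 1%nat)).
- exact (Ck_subset 1 D _ U HV (HU 1%nat)).
(* Expansion by [c] on the disc forces injectivity there. *)
- intros x y Hx Hy E. specialize (Hc x y Hx Hy).
  rewrite E in Hc. replace (u y - u y)%C with (RtoC 0) in Hc by ring. rewrite Cmod_0 in Hc.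
  pose proof (Cmod_ge_0 (y - x)). symmetry. apply Cminus_0_eq, Cmod_eq_0.
  apply Rle_antisym; [|assumption]. apply Rmult_le_reg_l with c; lra.
- auto.
- intros z Hz. auto.
- intros z Hz. auto.
Qed.

Lemma constant_curvature_sinh_gordon (K : R) (omega F : C -> R) (Omega W : C -> Prop)
    (U : C -> C) :
  open Omega -> open W -> smooth_real W F -> smooth Omega U ->
  (forall w, W w <-> image Omega U w) -> smooth_real Omega omega ->
  harmonic F Omega U -> hopf_coordinate F Omega U -> beltrami omega Omega U ->
  (forall z, Omega z -> jacobian U z <> 0) -> sinh_gordon K Omega omega ->
  constant_curvature K W F.
Proof.
intros HO HW HF HU Him Hw Hh Hc BU HJ SG w Hww.
destruct (proj1 (Him w) Hww) as (z & Hz & ->).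
assert (Hm : forall z, Omega z -> W (U z)) by (intros y Hy; apply Him; exists y; auto).
pose proof (gauss_curvature_sinh omega F Omega W U z HO HW HF HU Hm Hw Hh BU
  (hopf_coordinate_eq_1 F Omega U HO HU Hc z Hz) Hz) as E.
rewrite (SG z Hz) in E.
(* A zero of sinh(2 omega) would give m^2 = 1 and a vanishing Jacobian. *)
assert (s0 : RtoC (sinh (2 * omega z)) <> 0).
{ rewrite sinh_factor. intros E0.
  apply (proj1 (jacobian_neq_0_iff omega Omega U z BU Hz) (HJ z Hz)).
  pose proof (exp_pos (- 2 * omega z)) as mp.
  rewrite <- !RtoC_mult, <- RtoC_minus, <- RtoC_div in E0 by lra.
  apply (f_equal Re) in E0. simpl in E0.
  apply (f_equal (fun x => x * (2 * exp (- 2 * omega z)))) in E0.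
  rewrite Rmult_0_l in E0. rewrite <- E0. field. lra. }
transitivity (gauss_curvature F (U z) * RtoC (sinh (2 * omega z))
  / RtoC (sinh (2 * omega z)))%C; [field; exact s0|].
rewrite E, RtoC_mult, RtoC_opp, RtoC_div by lra. field. exact s0.
Qed.

(** The relation between [u] and [U] is symmetric, so factoring each through the other yields a
    holomorphic [f] and its holomorphic inverse. *)
Lemma beltrami_factor_biholomorphic (omega : C -> R) (Omega W : C -> Prop) (u U : C -> C) :
  diffeomorphism Omega (image Omega u) u -> diffeomorphism Omega W U ->
  beltrami omega Omega u -> beltrami omega Omega U ->
  exists f : C -> C, biholomorphic (image Omega u) f /\ forall z, Omega z -> U z = f (u z).
Proof.
assert (Hi : forall X v, diffeomorphism Omega X v -> injective_on Omega v).
{ intros X v (_ & _ & _ & _ & g & _ & Hg) z1 z2 H1 H2 E.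
  rewrite <- (Hg z1 H1), <- (Hg z2 H2), E. reflexivity. }
intros Du DU Bu BU. pose proof Du as (HO & Hou & Su & _). pose proof DU as (_ & _ & SU & _).
destruct (holomorphic_factor omega Omega u U HO (Su 1%nat) (SU 1%nat) (Hi _ _ Du)
  (diffeomorphism_jacobian _ _ _ Du) Bu BU) as (f & Hf & EU).
destruct (holomorphic_factor omega Omega U u HO (SU 1%nat) (Su 1%nat) (Hi _ _ DU)
  (diffeomorphism_jacobian _ _ _ DU) BU Bu) as (g & Hg & Eu).
assert (Eim : forall w, image Omega U w <-> image (image Omega u) f w).
{ intros w. split.
  - intros (z & Hz & ->). exists (u z). split; [exists z; auto|auto].
  - intros (v & (z & Hz & ->) & ->). exists z. split; [exact Hz|]. symmetry. auto. }
exists f. split; [|exact EU]. split; [exact Hf|]. exists g. split.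
- destruct Hg as [Hg1 Hg2]. split; [exact (open_ext _ _ Eim Hg1)|].
  intros w Hw. apply Hg2, Eim, Hw.
- intros v (z & Hz & ->). rewrite <- EU, <- Eu by exact Hz. reflexivity.
Qed.

(** * The metric attached to a Beltrami solution *)

Lemma Cmod_sqr_pos (a : C) : a <> 0 -> 0 < Cmod a ^ 2.
Proof. intros H. apply pow_lt, Cmod_gt_0, H. Qed.

Lemma smooth_ln_Cmod_sqr (D : C -> Prop) (a : C -> C) :
  open D -> smooth D a -> (forall z, D z -> a z <> 0) ->
  smooth_real D (fun z => ln (Cmod (a z) ^ 2)).
Proof.
intros HD Ha H0 k.
assert (K : Ck k D (fun z => a z * Cconj (a z))%C)
  by (apply Ck_mult; [exact HD|apply Ha|]; apply Ck_conj; [exact HD|apply Ha]).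
refine (Ck_ext _ _ _ _ HD _ (Ck_comp k D _ (fun w => RtoC (ln (Re w))) _ HD open_Re_pos
  _ (smooth_ln k) K)).
- intros z Hz. cbv beta. rewrite <- Cmod2_conj. reflexivity.
- intros z Hz. cbv beta. rewrite <- Cmod2_conj. apply (Cmod_sqr_pos _ (H0 z Hz)).
Qed.

(* The metric is forced by the Hopf differential: e^F |U_z|^2 exp(-2 omega) = 1. *)
Lemma hopf_metric_harmonic (omega F : C -> R) (Omega W : C -> Prop) (U : C -> C) :
  open Omega -> open W -> smooth_real W F -> smooth Omega U ->
  (forall z, Omega z -> W (U z)) -> smooth_real Omega omega -> beltrami omega Omega U ->
  (forall z, Omega z -> jacobian U z <> 0) ->
  (forall z, Omega z -> F (U z) = 2 * omega z - ln (Cmod (dz U z) ^ 2)) ->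
  harmonic F Omega U.
Proof.
intros HO HW HF HU Hm Hw BU HJ EF z Hz.
apply (harmonic_factor omega F Omega U z HO Hw HU BU Hz).
set (a := dz U). assert (Sa : smooth Omega a) by (apply smooth_dz; assumption).
pose proof (beltrami_dz_neq_0 _ _ _ _ BU Hz) as a0. fold a in a0.
assert (a0' : Cconj (a z) <> 0).
{ intros E. apply a0. rewrite <- (Cconj_conj (a z)), E. apply Cconj_RtoC. }
pose proof (smooth_cdiff _ _ _ HO HU Hz) as DU. fold a in DU.
rewrite (beltrami_dzbar _ _ _ _ BU Hz) in DU. fold a in DU.
pose proof (smooth_cdiff _ _ _ HO Sa Hz) as Da.
unfold a at 3 in Da. rewrite (beltrami_dzbar_dz omega Omega U z HO Hw HU BU Hz) in Da.
fold a in Da.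
pose proof (smooth_cdiff _ _ _ HO Hw Hz) as Dw. rewrite dzbar_real in Dw.
pose proof (smooth_cdiff _ _ _ HW HF (Hm z Hz)) as DF.
assert (LA : locally z (fun y : C => (a y * Cconj (a y))%C = RtoC (Cmod (a y) ^ 2)))
  by (apply filter_forall; intros y; symmetry; apply Cmod2_conj).
pose proof (cdiff_ext_loc _ (fun y => RtoC (Cmod (a y) ^ 2)) _ _ _ LA
  (cdiff_mult _ _ _ _ _ _ _ Da (cdiff_conj _ _ _ _ Da))) as DA.
pose proof (cdiff_ln_comp _ _ _ _ (Cmod_sqr_pos _ a0) DA) as DL.
pose proof (cdiff_minus _ _ _ _ _ _ _ (cdiff_scal _ (RtoC 2) _ _ _ Dw) DL) as DR.
pose proof (cdiff_comp (fun w => RtoC (F w)) U z _ _ _ _ DF DU) as DFU.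
apply cdiff_ext_loc with
  (g := fun y => (2 * RtoC (omega y) - RtoC (ln (Cmod (a y) ^ 2)))%C) in DFU.
2:{ apply filter_imp with (2 := HO z Hz). intros y Hy.
  rewrite (EF y Hy), RtoC_minus, RtoC_mult. reflexivity. }
pose proof (eq_trans (eq_sym (cdiff_dz _ _ _ _ DFU)) (cdiff_dz _ _ _ _ DR)) as X1.
pose proof (eq_trans (eq_sym (cdiff_dzbar _ _ _ _ DFU)) (cdiff_dzbar _ _ _ _ DR)) as X2.
pose proof (proj1 (jacobian_neq_0_iff omega Omega U z BU Hz) (HJ z Hz)) as j0.
cbv beta in X1, X2. rewrite Cmod2_conj in X1, X2.
rewrite !Cmult_conj, Cminus_conj, !Cmult_conj, !Cconj_RtoC in X1.
fold a.
set (P := dz (fun w => RtoC (F w)) (U z)) in *.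
set (Q := dzbar (fun w => RtoC (F w)) (U z)) in *.
set (w1 := dz (fun p => RtoC (omega p)) z) in *. set (b := dz a z) in *.
set (m := RtoC (exp (- 2 * omega z))) in *.
set (az := a z) in *. set (az' := Cconj az) in *. set (b' := Cconj b) in *.
set (w1' := Cconj w1) in *.
assert (mm : (1 - m * m)%C <> 0).
{ intros E. apply j0. apply (f_equal Re) in E. unfold m in E.
  rewrite <- RtoC_mult, <- RtoC_minus in E. simpl in E. simpl. lra. }
(* In the derivatives of F o U = 2 omega - ln |a|^2, subtracting m times the zbar-derivative from
   the z-derivative eliminates F_wbar and all conjugated terms; what remains is the harmonic map
   equation times 1 - m^2. *)
assert (G : ((1 - m * m) * (P * az * az - (2 * w1 * az - b)))%C = 0).
{ match type of X1 with ?l1 = ?r1 => match type of X2 with ?l2 = ?r2 =>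
    transitivity (az * ((l1 - r1) - m * (l2 - r2)))%C end end.
  - field. auto.
  - rewrite X1, X2. ring. }
apply Cminus_0_eq.
match goal with |- ?x = _ => transitivity ((1 - m * m) * x / (1 - m * m))%C end.
- field. exact mm.
- rewrite G. field. exact mm.
Qed.

Lemma hopf_coordinate_id (F : C -> R) (Omega : C -> Prop) (U : C -> C) :
  open Omega -> smooth Omega U ->
  (forall z, Omega z ->
     (RtoC (exp (F (U z))) * dz U z * Cconj (dzbar U z))%C = RtoC 1) ->
  hopf_coordinate F Omega U.
Proof.
intros HO HU H1.
assert (E1 : cexp (- RtoC 0) = 1 /\ cexp (- RtoC 0 / 2) = 1).
{ replace (- RtoC 0)%C with (RtoC 0) by ring.
  replace (RtoC 0 / 2)%C with (RtoC 0) by field.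
  unfold cexp. simpl. rewrite exp_0, cos_0, sin_0.
  split; apply injective_projections; simpl; ring. }
(* The Hopf coefficient is already 1, so zeta serves as its own source coordinate with lambda =
   0. *)
exists Omega, (fun _ => RtoC 0), (fun z => z). repeat apply conj.
- exact HO.
- intros z _. exists (RtoC 0). apply is_derive_C_iff, cdiff_const.
- intros z _. apply is_derive_C_iff. rewrite (proj2 E1). apply cdiff_id.
- intros z1 z2 _ _ E. exact E.
- intros z. split; [intros Hz; exists z; auto|intros (y & Hy & ->); exact Hy].
- intros z Hz. rewrite (proj1 E1), <- (H1 z Hz). unfold hopf. f_equal.
  exact (cdiff_dz _ _ _ _ (cdiff_conj _ _ _ _ (smooth_cdiff _ _ _ HO HU Hz))).
Qed.

(** A holomorphic [f] multiplies u_z and u_zbar by the same derivative, so their quotient is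
    unchanged; the holomorphic inverse of [f] keeps that derivative from vanishing. *)
Lemma beltrami_comp (omega : C -> R) (Omega : C -> Prop) (u U f : C -> C) :
  open Omega -> smooth Omega u -> beltrami omega Omega u ->
  biholomorphic (image Omega u) f -> (forall z, Omega z -> U z = f (u z)) ->
  beltrami omega Omega U.
Proof.
intros HO Su Bu (Hf & g & Hg & Hgf) EU z Hz.
assert (Hi : image Omega u (u z)) by (exists z; auto).
destruct Hf as [Ho Hf]. destruct (Hf (u z) Hi) as [c Hc].
destruct (proj2 Hg (f (u z))) as [c' Hc']; [exists (u z); auto|].
change C in c, c'. apply is_derive_C_iff in Hc. apply is_derive_C_iff in Hc'.
assert (c0 : c <> 0).
{ intros E. rewrite E in Hc.
  apply (jacobian_left_inverse f g (u z) _ _ _ _ Hc Hc').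
  - apply filter_imp with (2 := Ho (u z) Hi). exact Hgf.
  - unfold jacobian. rewrite (cdiff_dz _ _ _ _ Hc), (cdiff_dzbar _ _ _ _ Hc). ring. }
pose proof (cdiff_comp f u z _ _ _ _ Hc (smooth_cdiff _ _ _ HO Su Hz)) as DU.
apply cdiff_ext_loc with (g := U) in DU.
2:{ apply filter_imp with (2 := HO z Hz). intros y Hy. symmetry. exact (EU y Hy). }
rewrite (cdiff_dz _ _ _ _ DU), (cdiff_dzbar _ _ _ _ DU).
destruct (Bu z Hz) as [a0 E].
replace (c * dz u z + RtoC 0 * Cconj (dzbar u z))%C with (c * dz u z)%C by ring.
split.
- apply Cmult_neq_0; assumption.
- rewrite <- E. field. auto.
Qed.

(** The inverse is u^-1 o g with g = f^-1. Complex differentiability of [g] supplies only its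
    continuity, and [smooth_inverse] bootstraps the composite from there, so smoothness of
    holomorphic functions never has to be proved. *)
Lemma diffeomorphism_comp (omega : C -> R) (Omega : C -> Prop) (u U f : C -> C) :
  diffeomorphism Omega (image Omega u) u -> beltrami omega Omega u -> smooth Omega U ->
  biholomorphic (image Omega u) f -> (forall z, Omega z -> U z = f (u z)) ->
  diffeomorphism Omega (image Omega U) U.
Proof.
intros Du Bu SU Hf EU. pose proof (diffeomorphism_jacobian _ _ _ Du) as Ju.
destruct Du as (HO & Hou & Su & _ & gu & Sgu & Hgu).
pose proof (beltrami_comp omega Omega u U f HO Su Bu Hf EU) as BU.
assert (JU : forall z, Omega z -> jacobian U z <> 0).
{ intros z Hz. apply (proj2 (jacobian_neq_0_iff omega Omega U z BU Hz)).
  exact (proj1 (jacobian_neq_0_iff omega Omega u z Bu Hz) (Ju z Hz)). }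
destruct Hf as (Hf & g & Hg & Hgf).
assert (Eim : forall w, image (image Omega u) f w <-> image Omega U w).
{ intros w. split.
  - intros (v & (z & Hz & ->) & ->). exists z. split; [exact Hz|]. symmetry. auto.
  - intros (z & Hz & ->). exists (u z). split; [exists z; auto|auto]. }
assert (Hh : forall z, Omega z -> gu (g (U z)) = z).
{ intros z Hz. rewrite EU by exact Hz. rewrite Hgf by (exists z; auto). auto. }
assert (HoU : open (image Omega U)) by exact (open_ext _ _ Eim (proj1 Hg)).
split; [exact HO|]. split; [exact HoU|]. split; [exact SU|]. split; [reflexivity|].
exists (fun w => gu (g w)). split; [|exact Hh].
apply (smooth_inverse Omega _ U _ HO HoU SU JU).
- intros w (z & Hz & ->). rewrite Hh; exact Hz.
- intros w (z & Hz & ->). rewrite Hh; auto.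
- intros w Hw. destruct (proj2 Hg w (proj2 (Eim w) Hw)) as [c Hc].
  apply continuous_comp.
  + exact (cdiff_continuous _ _ _ _ (proj1 (is_derive_C_iff _ _ _) Hc)).
  + apply (proj1 (Sgu O)). destruct Hw as (z & Hz & ->). exists z. split; [exact Hz|].
    rewrite EU by exact Hz. apply Hgf. exists z; auto.
Qed.

Lemma hopf_metric_exists (K : R) (omega : C -> R) (Omega W : C -> Prop) (U : C -> C) :
  smooth_real Omega omega -> sinh_gordon K Omega omega ->
  diffeomorphism Omega W U -> beltrami omega Omega U ->
  exists F : C -> R, harmonic_diffeomorphism F Omega W U /\ constant_curvature K W F.
Proof.
intros Sw SG DU BU. pose proof (diffeomorphism_jacobian _ _ _ DU) as JU.
pose proof DU as (HO & HW & SU & Him & h & Sh & Hh).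
assert (Hm : forall z, Omega z -> W (U z)) by (intros z Hz; apply Him; exists z; auto).
set (Phi := fun z => 2 * omega z - ln (Cmod (dz U z) ^ 2)).
exists (fun w => Phi (h w)).
assert (SPhi : smooth_real Omega Phi).
{ intros k. refine (Ck_ext _ _ _ _ HO _ (Ck_minus k _ _ _ HO
    (Ck_scal k _ (RtoC 2) _ HO (Sw k))
    (smooth_ln_Cmod_sqr _ (dz U) HO (smooth_dz _ _ HO SU) _ k))).
  - intros z _. unfold Phi. rewrite RtoC_minus, RtoC_mult. reflexivity.
  - intros z Hz. exact (beltrami_dz_neq_0 _ _ _ _ BU Hz). }
(* The metric must be smooth on the target itself, which is where smoothness of the inverse [h] is
   spent. *)
assert (SF : smooth_real W (fun w => Phi (h w))).
{ intros k. refine (Ck_comp k W Omega _ h HW HO _ (SPhi k) (Sh k)).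
  intros w Hw. destruct (proj1 (Him w) Hw) as (z & Hz & ->). rewrite Hh; exact Hz. }
assert (EF : forall z, Omega z -> Phi (h (U z)) = 2 * omega z - ln (Cmod (dz U z) ^ 2))
  by (intros z Hz; rewrite Hh by exact Hz; reflexivity).
assert (Har : harmonic (fun w => Phi (h w)) Omega U)
  by exact (hopf_metric_harmonic omega _ Omega W U HO HW SF SU Hm Sw BU JU EF).
assert (Hc : hopf_coordinate (fun w => Phi (h w)) Omega U).
{ apply hopf_coordinate_id; [exact HO|exact SU|]. intros z Hz.
  rewrite EF, (beltrami_dzbar _ _ _ _ BU Hz), Cmult_conj, Cconj_RtoC by exact Hz.
  pose proof (Cmod_sqr_pos _ (beltrami_dz_neq_0 _ _ _ _ BU Hz)) as P.
  transitivity (RtoC (exp (2 * omega z - ln (Cmod (dz U z) ^ 2)))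
    * RtoC (exp (- 2 * omega z)) * (dz U z * Cconj (dz U z)))%C; [ring|].
  rewrite <- Cmod2_conj, <- !RtoC_mult. f_equal.
  rewrite <- (exp_ln _ P) at 2. rewrite <- !exp_plus. rewrite <- exp_0. f_equal. ring. }
split.
- split; [exact DU|]. auto.
- exact (constant_curvature_sinh_gordon K omega _ Omega W U HO HW SF SU Him Sw Har Hc BU JU SG).
Qed.

(** The normalization makes U_zbar / U_z equal to 1 / (e^F |U_z|^2), a positive real number, hence
    exp(-2 omega) for a unique real omega. *)
Lemma hopf_beltrami (F : C -> R) (W Omega : C -> Prop) (U : C -> C) :
  open Omega -> open W -> smooth_real W F -> smooth Omega U ->
  (forall z, Omega z -> W (U z)) ->
  (forall z, Omega z ->
     (RtoC (exp (F (U z))) * dz U z * Cconj (dzbar U z))%C = RtoC 1) ->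
  exists omega : C -> R, smooth_real Omega omega /\ beltrami omega Omega U.
Proof.
intros HO HW HF HU Hm H1.
assert (a0 : forall z, Omega z -> dz U z <> 0).
{ intros z Hz E. specialize (H1 z Hz). rewrite E in H1. apply C1_nz. rewrite <- H1. ring. }
exists (fun z => / 2 * (F (U z) + ln (Cmod (dz U z) ^ 2))). split.
- intros k. refine (Ck_ext _ _ _ _ HO _ (Ck_scal k _ (RtoC (/ 2)) _ HO (Ck_plus k _ _ _ HO
    (Ck_comp k Omega W _ U HO HW Hm (HF k) (HU k))
    (smooth_ln_Cmod_sqr _ (dz U) HO (smooth_dz _ _ HO HU) a0 k)))).
  intros z _. rewrite RtoC_mult, RtoC_plus. reflexivity.
- intros z Hz. specialize (a0 z Hz). specialize (H1 z Hz). split; [exact a0|].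
  pose proof (Cmod_sqr_pos _ a0) as P. pose proof (exp_pos (F (U z))) as Q.
  replace (- 2 * (/ 2 * (F (U z) + ln (Cmod (dz U z) ^ 2))))
    with (- (F (U z) + ln (Cmod (dz U z) ^ 2))) by field.
  rewrite exp_Ropp, exp_plus, exp_ln by exact P.
  rewrite RtoC_inv by (apply Rgt_not_eq, Rmult_lt_0_compat; assumption).
  rewrite RtoC_mult, Cmod2_conj.
  apply (f_equal Cconj) in H1.
  rewrite !Cmult_conj, !Cconj_RtoC, Cconj_conj in H1.
  set (q := RtoC (exp (F (U z)))) in *.
  assert (q0 : q <> 0) by (intros K; apply (f_equal Re) in K; simpl in K; lra).
  assert (a0' : Cconj (dz U z) <> 0)
    by (intros E; apply a0; rewrite <- (Cconj_conj (dz U z)), E; apply Cconj_RtoC).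
  transitivity ((q * Cconj (dz U z) * dzbar U z) / (q * (dz U z * Cconj (dz U z))))%C.
  + field. auto.
  + rewrite H1. field. auto.
Qed.

(** * Classification of harmonic diffeomorphisms *)

Theorem corollary3 :
  forall (KN : R) (Omega : C -> Prop),
  open Omega ->
  (forall (omega : C -> R) (u : C -> C),
     smooth_real Omega omega -> sinh_gordon KN Omega omega ->
     smooth Omega u -> beltrami omega Omega u ->
     (* U = f(u) with f holomorphic, and the target has constant curvature KN *)
     (forall (F : C -> R) (W : C -> Prop) (U : C -> C),
        harmonic_immersion F Omega W U -> beltrami omega Omega U ->
        (forall z0, Omega z0 ->
           exists V : C -> Prop,
             open V /\ V z0 /\ (forall z, V z -> Omega z) /\
             holomorphic_function_of V u U) /\
        (injective_on Omega u -> holomorphic_function_of Omega u U) /\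
        constant_curvature KN W F)
     /\
     (* the harmonic diffeomorphisms to surfaces of curvature KN attached to omega *)
     (diffeomorphism Omega (image Omega u) u ->
      forall U : C -> C, smooth Omega U ->
        ((exists (F : C -> R) (W : C -> Prop),
            harmonic_diffeomorphism F Omega W U /\ constant_curvature KN W F /\
            beltrami omega Omega U)
         <->
         (exists f : C -> C,
            biholomorphic (image Omega u) f /\
            forall z, Omega z -> U z = f (u z)))))
  /\
  (* every harmonic diffeomorphism to such a surface is attached to one omega *)
  (forall (F : C -> R) (W : C -> Prop) (U : C -> C),
     harmonic_diffeomorphism F Omega W U -> constant_curvature KN W F ->
     exists omega : C -> R,
       smooth_real Omega omega /\ sinh_gordon KN Omega omega /\
       beltrami omega Omega U /\
       forall omega' : C -> R, beltrami omega' Omega U ->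
         forall z, Omega z -> omega' z = omega z).
Proof.
intros KN Omega HO. split.
- intros omega u Sw SG Su Bu. split.
  + intros F W U (_ & HW & HF & HU & Him & HJ & Hh & Hc) BU.
    (* Nondegeneracy of the immersion [U] passes to [u] through the common [omega]. *)
    assert (Ju : forall z, Omega z -> jacobian u z <> 0).
    { intros z Hz. apply (proj2 (jacobian_neq_0_iff omega Omega u z Bu Hz)).
      exact (proj1 (jacobian_neq_0_iff omega Omega U z BU Hz) (HJ z Hz)). }
    split; [|split].
    * intros z0 Hz0.
      exact (local_holomorphic_factor omega Omega u U z0 HO Su HU Ju Bu BU Hz0).
    * intros Hi. exact (holomorphic_factor omega Omega u U HO (Su 1%nat) (HU 1%nat) Hi Ju Bu BU).
    * exact (constant_curvature_sinh_gordon KN omega F Omega W U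
        HO HW HF HU Him Sw Hh Hc BU HJ SG).
  + intros Du U HU. split.
    * intros (F & W & (DU & _) & _ & BU).
      exact (beltrami_factor_biholomorphic omega Omega W u U Du DU Bu BU).
    * intros (f & Hf & EU).
      pose proof (beltrami_comp omega Omega u U f HO Su Bu Hf EU) as BU.
      destruct (hopf_metric_exists KN omega Omega (image Omega U) U Sw SG
        (diffeomorphism_comp omega Omega u U f Du Bu HU Hf EU) BU) as (F & HF & HK).
      exists F, (image Omega U). auto.
- intros F W U (DU & HF & Hh & Hc) HK. destruct DU as (_ & HW & HU & Him & _).
  assert (Hm : forall z, Omega z -> W (U z)) by (intros z Hz; apply Him; exists z; auto).
  pose proof (hopf_coordinate_eq_1 F Omega U HO HU Hc) as H1.
  destruct (hopf_beltrami F W Omega U HO HW HF HU Hm H1) as (omega & Sw & BU).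
  exists omega. split; [exact Sw|]. split; [|split; [exact BU|]].
  (* The curvature identity read backwards: known curvature gives the sinh-Gordon equation. *)
  + intros z Hz.
    pose proof (gauss_curvature_sinh omega F Omega W U z HO HW HF HU Hm Sw Hh BU
      (H1 z Hz) Hz) as E.
    rewrite (HK _ (Hm z Hz)) in E.
    rewrite RtoC_mult, RtoC_opp, RtoC_div by lra.
    transitivity ((- (2) * dzbar (dz (fun p => RtoC (omega p))) z) / - (2))%C.
    * field.
    * rewrite <- E. field.
  + intros omega' B' z Hz. destruct (BU z Hz) as [_ E]. destruct (B' z Hz) as [_ E'].
    rewrite E in E'. apply RtoC_inj, exp_inv in E'. lra.
Qed.
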